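(* Let $\mathcal{Q}$ be a quasicrystal in $\mathbb{R}$, let $V=V_{\mathcal{Q}}:\mathbb{R}\to\mathbb{R}$ be a $C^2$ short range potential associated with $\mathcal{Q}$, and let $U:\mathbb{R}\to\mathbb{R}$ be a $C^2$ function with $U''(x)>0$ for all $x\in\mathbb{R}$ and $\lim_{x\to\pm\infty}U(x)/|x|=+\infty$. Consider minimal configurations for the Frenkel-Kontorova energy defined by $\mathcal{H}(\theta,\theta')=U(\theta-\theta')+V(\theta)$. Then: (i) every minimal configuration has a rotation number; (ii) the rotation number is a continuous function on the set of minimal configurations equipped with the product topology (the topology induced from $\mathbb{R}^{\mathbb{Z}}$); (iii) for every real $\rho\ge 0$ there exists a minimal configuration with rotation number $\rho$.
   Context: Quasicrystals. Let $\mathcal{Q}=(s_n)_{n\in\mathbb{Z}}$ be a bi-infinite strictly increasing sequence of reals, identified with the set $\{s_n\}\subset\mathbb{R}$. A segment of $\mathcal{Q}$ is a finite block $(s_n,\dots,s_{n+p})$; two segments $(s_n,\dots,s_{n+p})$ and $(s_q,\dots,s_{q+p})$ are equivalent if there is $\tau\in\mathbb{R}$ with $s_{q+i}=s_{n+i}+\tau$ for $i=0,\dots,p$. $\mathcal{Q}$ is a quasicrystal if: (a) (finite local complexity) for every $M>0$ there are only finitely many equivalence classes of segments of diameter smaller than $M$; (b) (repetitivity) for every segment $S$ there is $R>0$ such that every ball of radius $R$ in $\mathbb{R}$ contains a segment equivalent to $S$; (c) (uniform pattern distribution) for every segment $S$, $n(S,x,M)/M$ converges as $M\to+\infty$, uniformly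 in $x\in\mathbb{R}$, to a limit $\nu(S)$ independent of $x$, where $n(S,x,M)$ is the number of segments of $\mathcal{Q}$ equivalent to $S$ contained in $[x,x+M]$. (Periodic chains, called crystals, are quasicrystals.) Potentials. $B_M(z)=(z-M,z+M)$ is the ball of center $z$ and radius $M$. For $R>0$, $V:\mathbb{R}\to\mathbb{R}$ is a potential with range $R$ associated with $\mathcal{Q}$ if $V(x)=V(y)$ whenever $(\mathcal{Q}\cap B_R(x))-x=(\mathcal{Q}\cap B_R(y))-y$. A short range potential is a potential with range $R$ for some $R>0$. Configurations. A configuration is a bi-infinite non-decreasing sequence $(\theta_n)_{n\in\mathbb{Z}}$ of reals; a segment is a finite non-decreasing sequence $(\theta_i,\dots,\theta_{i+p})$. Put $\mathcal{H}_p(\theta_i,\dots,\theta_{i+p})=\sum_{j=0}^{p-1}\mathcal{H}(\theta_{i+j},\theta_{i+j+1})$. A segment $(\theta_i,\dots,\theta_{i+p})$ is minimal if $\mathcal{H}_p(\theta_i,\dots,\theta_{i+p})\le\mathcal{H}_p(\theta'_i,\dots,\theta'_{i+p})$ for every segment $(\theta'_i,\dots,\theta'_{i+p})$ with $\theta'_i=\theta_i$ and $\theta'_{i+p}=\theta_{i+p}$. A configuration is minimal if all its segments $(\theta_i,\dots,\theta_{i+p})$, $i\in\mathbb{Z}$, $p\geq 1$, are minimal. A configuration has rotation number $\rho\in\mathbb{R}$ if $\lim_{n\to+\infty}\theta_n/n=\lim_{n\to-\infty}\theta_n/n=\rho$. *)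

(* Defs.v *)
From HB Require Import structures.
From mathcomp Require Import all_boot all_order all_algebra.
From mathcomp Require Import finmap.
From mathcomp Require Import all_classical all_reals all_analysis.

Set Implicit Arguments.
Unset Strict Implicit.
Unset Printing Implicit Defensive.

Import Order.TTheory GRing.Theory Num.Theory.
Import numFieldNormedType.Exports.
Local Open Scope ring_scope.
Local Open Scope classical_set_scope.

(* The block (n, p) stands for the segment (s_n, ..., s_(n+p)) of s, which has
   p + 1 points. *)
Definition block : Type := (int * nat)%type.

Definition block_point (R : realType) (s : int -> R) (S : block) (i : nat) : R :=
  s (S.1 + i%:Z).

Definition block_in (R : realType) (s : int -> R) (A : set R) (S : block) : Prop :=
  forall i : nat, (i <= S.2)%N -> A (block_point s S i).

(* s is increasing, so the diameter is the last point minus the first one. *)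
Definition block_diam (R : realType) (s : int -> R) (S : block) : R :=
  block_point s S S.2 - block_point s S 0%N.

Definition block_equiv (R : realType) (s : int -> R) (S T : block) : Prop :=
  S.2 = T.2 /\
  exists tau : R, forall i : nat, (i <= S.2)%N ->
    block_point s T i = block_point s S i + tau.

Definition block_class (R : realType) (s : int -> R) (S : block) : set block :=
  [set T | block_equiv s S T].

Definition finite_local_complexity (R : realType) (s : int -> R) : Prop :=
  forall M : R, 0 < M ->
    finite_set [set block_class s S | S in [set S : block | block_diam s S < M]].

Definition repetitive (R : realType) (s : int -> R) : Prop :=
  forall S : block, exists r : R, 0 < r /\
    forall x : R, exists T : block, block_equiv s S T /\ block_in s (ball x r) T.

Definition equiv_blocks_in (R : realType) (s : int -> R) (S : block)
    (x M : R) : set block :=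
  [set T | block_equiv s S T /\ block_in s `[x, x + M] T].

(* fset_set is the empty set on an infinite argument; when s is increasing and
   repetitive only finitely many blocks of s lie in a bounded interval. *)
Definition block_count (R : realType) (s : int -> R) (S : block) (x M : R) : nat :=
  #|` fset_set (equiv_blocks_in s S x M)|%fset.

Definition uniform_pattern_distribution (R : realType) (s : int -> R) : Prop :=
  forall S : block, exists nu : R,
    forall e : R, 0 < e -> \forall M \near +oo, forall x : R,
      `|(block_count s S x M)%:R / M - nu| < e.

Definition quasicrystal (R : realType) (s : int -> R) : Prop :=
  [/\ {homo s : m n / m < n},
      finite_local_complexity s,
      repetitive s
    & uniform_pattern_distribution s].

(* (Q `&` B_r(x)) - x, with Q the set of values of s. *)
Definition local_patch (R : realType) (s : int -> R) (r x : R) : set R :=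
  [set z - x | z in range s `&` ball x r].

Definition potential_with_range (R : realType) (s : int -> R) (r : R)
    (V : R -> R) : Prop :=
  forall x y : R, local_patch s r x = local_patch s r y -> V x = V y.

Definition short_range_potential (R : realType) (s : int -> R)
    (V : R -> R) : Prop :=
  exists r : R, 0 < r /\ potential_with_range s r V.

Definition C2 (R : realType) (f : R -> R) : Prop :=
  [/\ forall x : R, derivable f x 1,
      forall x : R, derivable f^`() x 1
    & continuous f^`(2)].

Definition FK_energy (R : realType) (U V : R -> R) (t t' : R) : R :=
  U (t - t') + V t.

(* A finite sequence (t_0, ..., t_p) is given by a function on nat of which
   only the values at 0, ..., p are relevant. *)
Definition nondecreasing_upto (R : realType) (p : nat) (t : nat -> R) : Prop :=
  forall j k : nat, (j <= k <= p)%N -> t j <= t k.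

Definition segment_energy (R : realType) (H : R -> R -> R) (p : nat)
    (t : nat -> R) : R :=
  \sum_(0 <= j < p) H (t j) (t j.+1).

Definition minimal_segment (R : realType) (H : R -> R -> R) (p : nat)
    (t : nat -> R) : Prop :=
  nondecreasing_upto p t /\
  forall t' : nat -> R, nondecreasing_upto p t' ->
    t' 0%N = t 0%N -> t' p = t p ->
    segment_energy H p t <= segment_energy H p t'.

Definition configuration (R : realType) (theta : int -> R) : Prop :=
  {homo theta : m n / m <= n}.

Definition minimal_configuration (R : realType) (H : R -> R -> R)
    (theta : int -> R) : Prop :=
  configuration theta /\
  forall (i : int) (p : nat), (1 <= p)%N ->
    minimal_segment H p (fun j : nat => theta (i + j%:Z)).

Definition has_rotation_number (R : realType) (theta : int -> R)
    (rho : R) : Prop :=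
  (theta n%:Z / n%:R @[n --> \oo] --> rho) /\
  (theta (- n%:Z) / (- n%:R) @[n --> \oo] --> rho).

(* Total, with an unspecified value when there is no rotation number. The domain
   carries the product topology of R^Z. *)
Definition rotation_number (R : realType) (theta : {ptws int -> R}) : R :=
  get [set rho : R | has_rotation_number theta rho].

(* Main.v *)
(* If two intervals carry the same potential up to a translation and a minimal
   segment crosses one of them, then the other one contains at most two more of
   its points.  Otherwise the two pieces, superposed by the translation, cross
   twice with different index shifts, and exchanging what lies between the
   crossings moves one point from one interval to the other.  By strict convexity
   of U the energy drops, or else stays equal and creates a kink that violates the
   Euler-Lagrange equation.
   Since the patterns of a given length fall into finitely many classes, each of
   which recurs with a uniform frequency, averaging these counts over all patterns
   of p consecutive gaps of the quasicrystal shows that the density of points of a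
   minimal segment is the same in all long windows, up to O(1/p) and with a window
   length that does not depend on the segment.
   Hence a minimal configuration is either bounded or unbounded on both sides with
   a positive density b, so that its rotation number is 0 or 1/b; it is determined
   up to a small error by finitely many points, whence continuity.  For rho > 0,
   minimal segments with N steps and total length rho N have density close to
   1/rho in every long window, and so do their limits; for rho = 0 take a constant
   configuration. *)
Require Import Defs.
From HB Require Import structures.
From mathcomp Require Import all_boot all_order all_algebra.
From mathcomp Require Import finmap.
From mathcomp Require Import all_classical all_reals all_analysis.
From mathcomp Require Import ring lra zify.

Set Implicit Arguments.
Unset Strict Implicit.
Unset Printing Implicit Defensive.

Import Order.TTheory GRing.Theory Num.Theory.
Import numFieldNormedType.Exports.
Local Open Scope ring_scope.
Local Open Scope classical_set_scope.

(* [lia] and [lra] preprocess every hypothesis, which is very slow in the large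
   contexts below. *)
Ltac natlia := repeat match goal with
  | H : is_true (@Order.le _ _ _ _) |- _ => clear H
  | H : is_true (@Order.lt _ _ _ _) |- _ => clear H
  | H : forall _, _ |- _ => clear H
  end; lia.

Ltac ilia := repeat match goal with H : forall _, _ |- _ => clear H end;
  try match goal with RR : realType |- _ =>
    repeat match goal with H : ?T |- _ =>
      lazymatch T with context [RR] => clear H end end end;
  lia.

Ltac olra := repeat match goal with
  | H : is_true (@Order.le _ _ _ _) |- _ => clear H
  | H : is_true (@Order.lt _ _ _ _) |- _ => clear H
  end; lra.

(** * Convexity and one-sided Euler-Lagrange conditions *)

(** Configurations are only nondecreasing: points may coincide, and a point moves freely only
    between its neighbours. The Euler-Lagrange equation is therefore available only as two one-sided
    inequalities, and plateaus must be excluded before a kink yields a contradiction. Two equivalent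
    patterns have counts that differ by at most a constant, whatever their length; this is why
    averaging over patterns of [p] gaps leaves an error of order 1/p. The frequencies apply only to
    weights that depend on the class of a pattern, which the counts do not; the smallest count met
    in the reference window serves as weight. No threshold may depend on the segment, because
    continuity and the passage to the limit rest on this uniformity. Once [uniform_density] and
    [uniform_jump_bound] are proved, neither the quasicrystal nor the exchange argument is used
    again. *)

Section OneVariable.
Context {R : realType}.
Implicit Types (f U V : R -> R) (c d p n : R).

Lemma is_derive1_approx f c d : is_derive c 1 f d ->
  forall e, 0 < e -> exists2 h0, 0 < h0 &
    forall h, `|h| < h0 -> `|f (c + h) - f c - d * h| <= e * `|h|.
Proof.
move=> fd e e0; have [dfc dE] := fd.
have : (fun h => h^-1 *: ((f \o shift c) (h *: 1) - f c)) @ 0^' --> d.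
  by rewrite -dE; exact: dfc.
move/cvgrPdist_le => /(_ _ e0)[h0 /= h00 H]; exists h0 => // h hh0.
have [->|hn0] := eqVneq h 0; first by rewrite addr0 !mulr0 normr0 !subrr normr0 mulr0.
have := H h; rewrite /= sub0r normrN => /(_ hh0 hn0).
rewrite (_ : h%:A = h) ?[h%:A]mulr1 // (addrC h c) => K.
have -> : f (c + h) - f c - d * h = - (d - h^-1 * (f (c + h) - f c)) * h by field.
by rewrite normrM normrN ler_wpM2r.
Qed.

(** One-sided because a point that coincides with its left neighbour can be moved to the right
    only. *)
Lemma derive_ge0_right_min f c d n : is_derive c 1 f d -> c < n ->
  (forall t, c <= t <= n -> f c <= f t) -> 0 <= d.
Proof.
move=> fd cn H; rewrite leNgt; apply/negP => d0.
have [|h0 h00 K] := @is_derive1_approx f c d fd (- d / 2); first by lra.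
pose h := Num.min (h0 / 2) (n - c).
have hp : 0 < h by rewrite lt_min; apply/andP; split; lra.
have h1 : h <= h0 / 2 by rewrite ge_min lexx.
have h2 : h <= n - c by rewrite ge_min lexx orbT.
have := K h; rewrite gtr0_norm // => /(_ ltac:(lra)) /ler_normlP[_ K1].
have := H (c + h) ltac:(apply/andP; split; lra) => H1.
by have : d * h < 0 by [rewrite nmulr_rlt0]; nra.
Qed.

Lemma derive_le0_left_min f c d p : is_derive c 1 f d -> p < c ->
  (forall t, p <= t <= c -> f c <= f t) -> d <= 0.
Proof.
move=> fd pc H.
have fN : is_derive (- c) 1 (f \o -%R) (- d).
  have -> : - d = d * -1 by rewrite mulrN1.
  by apply: (@is_derive1_comp _ f -%R); rewrite opprK.
suff : 0 <= - d by lra.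
apply: (@derive_ge0_right_min _ (- c) _ (- p) fN); first lra.
by move=> t /andP[t1 t2] /=; rewrite opprK; apply: H; apply/andP; split; lra.
Qed.

Lemma is_derive_derive1 f x : derivable f x 1 -> is_derive x 1 f (derive1 f x).
Proof. by move=> /derivableP; rewrite derive1E. Qed.

Lemma is_derive_subr f a x : derivable f (x - a) 1 ->
  is_derive x 1 (fun t => f (t - a)) (derive1 f (x - a)).
Proof.
move=> df; rewrite -[derive1 f _]mulr1.
apply: (@is_derive1_comp _ f (fun t => t - a)); first exact: is_derive_derive1.
by rewrite -[X in is_derive _ _ _ X]subr0; apply: is_deriveB.
Qed.

Lemma is_derive_rsub f a x : derivable f (a - x) 1 ->
  is_derive x 1 (fun t => f (a - t)) (- derive1 f (a - x)).
Proof.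
move=> df; rewrite -mulrN1.
apply: (@is_derive1_comp _ f (fun t => a - t)); first exact: is_derive_derive1.
by rewrite -[X in is_derive _ _ _ X]sub0r; apply: is_deriveB.
Qed.

Section Convex.
Variable U : R -> R.
Hypothesis dU : forall x, derivable U x 1.
Hypothesis ddU : forall x, derivable U^`() x 1.
Hypothesis U2 : forall x, 0 < U^`(2) x.

Lemma derive1_homo_lt : {homo U^`() : x y / x < y}.
Proof.
move=> x y xy.
have [||z zxy E] := @MVT _ (U^`()) (U^`(2)) _ _ xy.
- by move=> t _; apply: is_derive_derive1.
- by apply: derivable_within_continuous => t _.
by have := mulr_gt0 (U2 z) (_ : 0 < y - x); rewrite subr_gt0 -E => /(_ xy); rewrite subr_gt0.
Qed.

(* The function [t |-> U (t - y) - U (t - x)] is increasing. *)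
Lemma convex_crossing_lt u w x y : u < w -> y < x ->
  U (u - y) + U (w - x) < U (w - y) + U (u - x).
Proof.
move=> uw yx; pose h t := U (t - y) - U (t - x).
pose dh (t : R) := derive1 U (t - y) - derive1 U (t - x).
have D (t : R) : is_derive t 1 h (dh t).
  by rewrite /h /dh; apply: is_deriveB; exact: is_derive_subr.
have hc : {within `[u, w], continuous h}.
  by apply: derivable_within_continuous => t _; have [] := D t.
have [z _ E] := MVT uw (fun t _ => D t) hc.
have : 0 < dh z * (w - u).
  apply: mulr_gt0; rewrite subr_gt0 //; apply: derive1_homo_lt; lra.
by rewrite -E /h; lra.
Qed.

Lemma convex_crossing u w x y : u <= w -> y <= x ->
  U (u - y) + U (w - x) <= U (w - y) + U (u - x).
Proof.
rewrite le_eqVlt => /orP[/eqP-> //|uw]; rewrite le_eqVlt.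
move=> /orP[/eqP->|yx]; first by rewrite addrC.
exact/ltW/convex_crossing_lt.
Qed.

Variable V : R -> R.
Hypothesis dV : forall x, derivable V x 1.

(** The part of the energy that depends on a point [t] with neighbours [p] and [n]. *)
Definition site_energy p n t := U (p - t) + V t + U (t - n).

Lemma is_derive_site_energy p n c :
  is_derive c 1 (site_energy p n) (- derive1 U (p - c) + derive1 V c + derive1 U (c - n)).
Proof.
apply: is_deriveD; first apply: is_deriveD.
- exact: is_derive_rsub.
- exact: is_derive_derive1.
- exact: is_derive_subr.
Qed.

Lemma site_energy_right_min p n c : c < n ->
  (forall t, c <= t <= n -> site_energy p n c <= site_energy p n t) ->
  derive1 U (p - c) <= derive1 V c + derive1 U (c - n).
Proof.
move=> cn H; have := derive_ge0_right_min (is_derive_site_energy p n c) cn H; lra.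
Qed.

Lemma site_energy_left_min p n c : p < c ->
  (forall t, p <= t <= c -> site_energy p n c <= site_energy p n t) ->
  derive1 V c + derive1 U (c - n) <= derive1 U (p - c).
Proof.
move=> cn H; have := derive_le0_left_min (is_derive_site_energy p n c) cn H; lra.
Qed.

End Convex.
End OneVariable.

(** * Energies of finite chains *)

Section Chains.
Context {R : realType}.
Variable H : R -> R -> R.
Implicit Types (t : nat -> R) (l A : seq R) (i n N : nat).

(** Lists make cutting and pasting a concatenation, also when the pasted piece has another number of
    points than the one removed. *)
Fixpoint chain_energy (x : R) (l : seq R) : R :=
  if l is y :: l' then H x y + chain_energy y l' else 0.

Definition stretch t i n : seq R := [seq t q | q <- iota i n].

Lemma chain_energy_cat x l1 l2 :
  chain_energy x (l1 ++ l2) = chain_energy x l1 + chain_energy (last x l1) l2.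
Proof. by elim: l1 x => [|y l1 IH] x /=; rewrite ?add0r // IH addrA. Qed.

Lemma chain_energy_rcons x l y :
  chain_energy x (rcons l y) = chain_energy x l + H (last x l) y.
Proof. by rewrite -cats1 chain_energy_cat /= addr0. Qed.

Lemma size_stretch t i n : size (stretch t i n) = n.
Proof. by rewrite size_map size_iota. Qed.

Lemma stretch_cat t i n1 n2 :
  stretch t i (n1 + n2) = stretch t i n1 ++ stretch t (i + n1) n2.
Proof. by rewrite /stretch iotaD map_cat. Qed.

Lemma stretchSr t i n : stretch t i n.+1 = rcons (stretch t i n) (t (i + n)%N).
Proof. by rewrite -addn1 stretch_cat cats1. Qed.

Lemma last_stretch t i n : last (t i) (stretch t i.+1 n) = t (i + n)%N.
Proof. by case: n => [|n]; rewrite ?addn0 // stretchSr last_rcons addSnnS. Qed.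

Lemma chain_energy_stretch t i n :
  chain_energy (t i) (stretch t i.+1 n) = \sum_(i <= j < i + n) H (t j) (t j.+1).
Proof.
elim: n => [|n IH]; first by rewrite addn0 big_geq.
rewrite stretchSr chain_energy_rcons IH last_stretch addnS big_nat_recr ?leq_addr //=.
Qed.

Lemma path_stretch t i n :
  (forall j k, (i <= j <= k)%N -> (k <= i + n)%N -> t j <= t k) ->
  path <=%R (t i) (stretch t i.+1 n).
Proof.
elim: n i => [//|n IH] i h /=; apply/andP; split; first by apply: h; lia.
by apply: IH => j k jk kn; apply: h; lia.
Qed.

Lemma minimal_segment_chain N t : minimal_segment H N t ->
  forall l, size l = N -> path <=%R (t 0%N) l -> last (t 0%N) l = t N ->
  chain_energy (t 0%N) (stretch t 1 N) <= chain_energy (t 0%N) l.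
Proof.
move=> [_ tmin] l sl pl ll.
pose t' j := nth (t 0%N) (t 0%N :: l) j.
have tl : stretch t' 1 N = l.
  apply: (@eq_from_nth _ (t 0%N)); rewrite size_stretch // => i iN.
  by rewrite (nth_map 0%N) ?size_iota // nth_iota.
rewrite -[in leRHS]tl -[in leRHS](_ : t' 0%N = t 0%N) //.
rewrite !(@chain_energy_stretch _ 0) !add0n; apply: tmin => //; last first.
  by rewrite -ll -sl /t' nth_last.
move=> j k /andP[jk kN]; apply: (@sorted_leq_nth _ <=%R) => //.
- exact: le_trans.
- by rewrite inE /= sl; lia.
- by rewrite inE /= sl; lia.
Qed.

Section Replace.
Variables (N : nat) (t : nat -> R).
Hypothesis tmin : minimal_segment H N t.

Let tnd j k : (j <= k)%N -> (k <= N)%N -> t j <= t k.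
Proof. by move=> jk kN; apply: tmin.1; rewrite jk. Qed.

Let pathP i n : (i + n <= N)%N -> path <=%R (t i) (stretch t i.+1 n).
Proof. by move=> iN; apply: path_stretch => j k ? ?; apply: tnd; lia. Qed.

Lemma replace_piece i n A : (i + n.+1 <= N)%N -> size A = n ->
  path <=%R (t i) (rcons A (t (i + n.+1)%N)) ->
  chain_energy (t i) (stretch t i.+1 n.+1) <=
  chain_energy (t i) (rcons A (t (i + n.+1)%N)).
Proof.
move=> iN sA pA; set j := (i + n.+1)%N in iN pA *.
pose l := stretch t 1 i ++ rcons A (t j) ++ stretch t j.+1 (N - j).
have := minimal_segment_chain tmin (l := l).
have -> : stretch t 1 N = stretch t 1 i ++ stretch t i.+1 n.+1 ++ stretch t j.+1 (N - j).
  rewrite [X in stretch t 1 X](_ : N = i + (n.+1 + (N - j)))%N; last by lia.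
  by rewrite !stretch_cat !add1n; congr (_ ++ (_ ++ stretch _ _ _)); lia.
rewrite /l !chain_energy_cat !last_stretch add0n !last_cat !last_stretch !last_rcons.
rewrite !last_stretch !size_cat !size_rcons !size_stretch !cat_path !last_stretch.
rewrite !last_rcons add0n -/j.
move=> h; rewrite -(lerD2r (chain_energy (t j) (stretch t j.+1 (N - j)))).
rewrite -(lerD2l (chain_energy (t 0%N) (stretch t 1 i))); apply: h; rewrite ?sA.
- by lia.
- by rewrite pA !pathP //; lia.
- by congr t; lia.
Qed.

(** Only the total number of points is kept, so points may pass from one piece to the other; the
    indices in between are then shifted, which leaves their energy unchanged. *)
Lemma replace_two_pieces i1 n1 i2 n2 A1 A2 :
  (i1 + n1.+1 <= i2)%N -> (i2 + n2.+1 <= N)%N ->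
  (size A1 + size A2 = n1 + n2)%N ->
  path <=%R (t i1) (rcons A1 (t (i1 + n1.+1)%N)) ->
  path <=%R (t i2) (rcons A2 (t (i2 + n2.+1)%N)) ->
  chain_energy (t i1) (stretch t i1.+1 n1.+1) +
    chain_energy (t i2) (stretch t i2.+1 n2.+1) <=
  chain_energy (t i1) (rcons A1 (t (i1 + n1.+1)%N)) +
    chain_energy (t i2) (rcons A2 (t (i2 + n2.+1)%N)).
Proof.
move=> i12 iN sA pA1 pA2.
set j1 := (i1 + n1.+1)%N in i12 pA1 *; set j2 := (i2 + n2.+1)%N in iN pA2 *.
pose l := stretch t 1 i1 ++ rcons A1 (t j1) ++ stretch t j1.+1 (i2 - j1) ++
  rcons A2 (t j2) ++ stretch t j2.+1 (N - j2).
have := minimal_segment_chain tmin (l := l).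
have -> : stretch t 1 N = stretch t 1 i1 ++ stretch t i1.+1 n1.+1 ++
    stretch t j1.+1 (i2 - j1) ++ stretch t i2.+1 n2.+1 ++ stretch t j2.+1 (N - j2).
  rewrite [X in stretch t 1 X](_ : N =
    i1 + (n1.+1 + (i2 - j1 + (n2.+1 + (N - j2)))))%N; last by lia.
  rewrite !stretch_cat !add1n; 
  congr (_ ++ (_ ++ (stretch _ _ _ ++ (stretch _ _ _ ++ stretch _ _ _))));
    lia.
rewrite /l !chain_energy_cat !last_stretch add0n !last_cat !last_stretch !last_rcons.
rewrite !last_stretch !size_cat !size_rcons !size_stretch !cat_path !last_stretch.
rewrite !last_rcons add0n -/j1 !last_stretch.
have -> : (j1 + (i2 - j1) = i2)%N by lia.
rewrite last_stretch -/j2 => h; move: h.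
have -> : (i1 + ((size A1).+1 + (i2 - j1 + ((size A2).+1 + (N - j2)))) = N)%N by lia.
have -> : (j2 + (N - j2) = N)%N by lia.
rewrite pA1 pA2 !pathP; try lia.
by move=> /(_ erefl erefl erefl); lra.
Qed.

Lemma replace_two_disjoint_pieces i1 n1 i2 n2 A1 A2 :
  (i1 + n1.+1 <= N)%N -> (i2 + n2.+1 <= N)%N ->
  (i1 + n1.+1 <= i2)%N \/ (i2 + n2.+1 <= i1)%N ->
  (size A1 + size A2 = n1 + n2)%N ->
  path <=%R (t i1) (rcons A1 (t (i1 + n1.+1)%N)) ->
  path <=%R (t i2) (rcons A2 (t (i2 + n2.+1)%N)) ->
  chain_energy (t i1) (stretch t i1.+1 n1.+1) +
    chain_energy (t i2) (stretch t i2.+1 n2.+1) <=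
  chain_energy (t i1) (rcons A1 (t (i1 + n1.+1)%N)) +
    chain_energy (t i2) (rcons A2 (t (i2 + n2.+1)%N)).
Proof.
move=> i1N i2N [i12|i21] sA p1 p2; first exact: replace_two_pieces.
by rewrite addrC [leRHS]addrC; apply: replace_two_pieces => //; rewrite addnC sA addnC.
Qed.

End Replace.
End Chains.

(** * Exchange argument *)

(** A discrete intermediate value property, used to locate crossings. *)
Lemma exists_last_true (P : pred nat) i k : (i <= k)%N -> P i -> ~~ P k ->
  exists j, [/\ (i <= j < k)%N, P j & ~~ P j.+1].
Proof.
move=> ik Pi; rewrite -(subnKC ik); elim: (k - i)%N => [|n IH].
  by rewrite addn0 Pi.
rewrite addnS; have [Pn nP|/IH[j [/andP[? ?] ? ?]] _] := boolP (P (i + n)%N).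
  by exists (i + n)%N; split => //; lia.
by exists j; split => //; lia.
Qed.

Section Aubry.
Context {R : realType}.
Variables U V : R -> R.
Hypothesis dU : forall x, derivable U x 1.
Hypothesis ddU : forall x, derivable U^`() x 1.
Hypothesis U2 : forall x, 0 < U^`(2) x.
Hypothesis dV : forall x, derivable V x 1.

Local Notation H := (FK_energy U V).
Local Notation energy := (chain_energy H).
Implicit Types (t : nat -> R) (X Y : seq R).

(** Swapping the interiors of two chains keeps the sites, so the [V] terms cancel. Only the links
    next to the four ends change, and [convex_crossing] handles each pair of them. *)
Lemma exchange_cons u w v z x X y Y : u <= w -> y <= x ->
  last x X <= last y Y -> z <= v ->
  energy u (rcons (y :: Y) v) + energy w (rcons (x :: X) z) <=
  energy u (rcons (x :: X) v) + energy w (rcons (y :: Y) z).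
Proof.
move=> uw yx l zv; rewrite /= !chain_energy_rcons /FK_energy.
have := convex_crossing dU ddU U2 uw yx; have := convex_crossing dU ddU U2 l zv.
lra.
Qed.

Lemma exchange_cons_lt u w v z x X y Y : u < w -> y < x ->
  last x X <= last y Y -> z <= v ->
  energy u (rcons (y :: Y) v) + energy w (rcons (x :: X) z) <
  energy u (rcons (x :: X) v) + energy w (rcons (y :: Y) z).
Proof.
move=> uw yx l zv; rewrite /= !chain_energy_rcons /FK_energy.
have := convex_crossing_lt dU ddU U2 uw yx; have := convex_crossing dU ddU U2 l zv.
lra.
Qed.

(** Here one interior is empty and both crossings lie on the link from [u] to [v]. The crossing
    inequality is applied twice, the intermediate term [U (u - z)] cancelling. *)
Lemma exchange_nil u w y z v : u <= w -> w <= y -> y <= z -> z <= v ->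
  energy u [:: y; v] + energy w [:: z] <= energy u [:: v] + energy w [:: y; z].
Proof.
move=> uw wy yz zv; rewrite /= /FK_energy.
have := convex_crossing dU ddU U2 uw yz.
have := convex_crossing dU ddU U2 (le_trans uw wy) zv.
lra.
Qed.

Lemma exchange_nil_lt u w y z v : u < w -> w <= y -> y <= z -> z < v ->
  energy u [:: y; v] + energy w [:: z] < energy u [:: v] + energy w [:: y; z].
Proof.
move=> uw wy yz zv; rewrite /= /FK_energy.
have := convex_crossing dU ddU U2 (ltW uw) yz.
have := convex_crossing_lt dU ddU U2 (lt_le_trans uw wy) zv.
lra.
Qed.

(** The last point [y] needs no condition, since [V] is evaluated at the left end of each link. *)
Lemma chain_energy_translate tau x X y :
  (forall q, q \in x :: X -> V (q - tau) = V q) ->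
  energy (x - tau) (rcons [seq q - tau | q <- X] (y - tau)) = energy x (rcons X y).
Proof.
elim: X x => [|x1 X IH] x h /=.
  by rewrite /FK_energy h ?inE ?eqxx // (_ : x - tau - (y - tau) = x - y) //; ring.
rewrite IH => [|q qX]; last by apply: h; rewrite in_cons qX orbT.
rewrite /FK_energy h ?inE ?eqxx // (_ : x - tau - (x1 - tau) = x - x1) //; ring.
Qed.

(** * Exchanges inside a single minimal segment *)

Section Minimal.
Variables (N : nat) (t : nat -> R).
Hypothesis tmin : minimal_segment H N t.

Lemma minimal_segment_le j k : (j <= k)%N -> (k <= N)%N -> t j <= t k.
Proof. by move=> jk kN; apply: tmin.1; rewrite jk. Qed.
Let tnd := minimal_segment_le.

Lemma minimal_segment_site i x : (i.+2 <= N)%N -> t i <= x <= t i.+2 ->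
  site_energy U V (t i) (t i.+2) (t i.+1) <= site_energy U V (t i) (t i.+2) x.
Proof.
move=> iN /andP[ix xi].
have := @replace_piece _ _ _ _ tmin i 1 [:: x].
rewrite /= addn2 /FK_energy ix xi /= /site_energy => /(_ iN erefl erefl); lra.
Qed.

(* A plateau strictly inside a minimal segment would be pushed to the left by its
   first point and to the right by its last one. *)
Lemma minimal_segment_no_plateau a i : (a < i)%N -> (i < N)%N ->
  t a < t i -> t i < t i.+1 -> t i.-1 < t i.
Proof.
move=> ai iN tai ti; rewrite lt_neqAle tnd ?andbT; try natlia.
apply/negP => /eqP tE.
have [q qi qmin] := @ex_minnP (fun q => t i <= t q) (ex_intro _ i (lexx _)).
have qi1 : (q <= i.-1)%N by apply: qmin; rewrite tE.
have aq : (a < q)%N.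
  by rewrite ltnNge; apply/negP => qa; have := tnd qa ltac:(natlia); lra.
have tq : t q = t i.
  by apply/eqP; rewrite eq_le qi andbT -tE tnd //; natlia.
have tq1 : t q.+1 = t i.
  by apply/eqP; rewrite eq_le tnd ?(le_trans qi) ?tnd //; natlia.
have tq' : t q.-1 < t i.
  by rewrite ltNge; apply/negP => /qmin; natlia.
(* [q] is the first index of the plateau and [i] its last. With [A], the inequality [L] makes the
   derivative of [V] at [t i] negative; with [B], the inequality [K] makes it positive. *)
have L : derive1 V (t i) + derive1 U (t i - t i) <= derive1 U (t q.-1 - t i).
  apply: (site_energy_left_min dU dV tq') => x /andP[x1 x2].
  have := @minimal_segment_site q.-1 x; rewrite !prednK; try natlia.
  by rewrite tq tq1 x1 x2; apply; natlia.
have K : derive1 U (t i - t i) <= derive1 V (t i) + derive1 U (t i - t i.+1).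
  apply: (site_energy_right_min dU dV ti) => x /andP[x1 x2].
  have := @minimal_segment_site i.-1 x; rewrite !prednK; try natlia.
  by rewrite tE x1 x2; apply; natlia.
have A : derive1 U (t q.-1 - t i) < derive1 U (t i - t i).
  by apply: (derive1_homo_lt ddU U2); rewrite ltrD2r.
have B : derive1 U (t i - t i.+1) < derive1 U (t i - t i).
  by apply: (derive1_homo_lt ddU U2); rewrite ltrD2l ltrN2.
move: L K A B; olra.
Qed.

(* Exchanging the pieces between the two crossings moves one point from the
   stretch of index [r] to the stretch of index [p]. *)
Lemma minimal_segment_no_double_crossing tau x z b p r d :
  (forall y, x <= y < z -> V (y + tau) = V y) ->
  (b <= p)%N -> t b < x -> (p + d.+1 <= N)%N -> (r + d.+2 <= N)%N ->
  (p + d.+1 <= r)%N \/ (r + d.+2 <= b)%N ->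
  x <= t r - tau -> t (r + d.+2)%N - tau < z ->
  t p <= t r - tau -> t r.+1 - tau < t p.+1 ->
  t (p + d)%N <= t (r + d.+1)%N - tau -> t (r + d.+2)%N - tau < t (p + d.+1)%N ->
  False.
Proof.
move=> hV bp tbx pN rN disj xr rz c1 c1' c2 c2'.
set u := t p in c1 *; set w := t r - tau in xr c1 *.
pose v := t (p + d.+1)%N; pose zz := t (r + d.+2)%N - tau.
(* [Y] is the interior of the second piece pulled back over the first, [X'] the interior of the
   first pushed onto the second. [Y] has one point more than [X]. *)
pose X := stretch t p.+1 d; pose Y := [seq q - tau | q <- stretch t r.+1 d.+1].
pose X' := [seq q + tau | q <- X].
have VJ j : (r <= j <= r + d.+2)%N -> V (t j - tau) = V (t j).
  move=> /andP[rj jr]; rewrite -[in RHS](subrK tau (t j)) hV //.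
  rewrite (le_trans xr) ?lerB ?(le_lt_trans _ rz) ?lerB ?tnd //; natlia.
have VX q : q \in X -> V (q + tau) = V q.
  move=> /mapP[j]; rewrite mem_iota => /andP[j1 j2] ->; apply: hV.
  have : t p.+1 <= t j by apply: tnd; natlia.
  have : t j <= t (p + d)%N by apply: tnd; natlia.
  have : t r <= t r.+1 by apply: tnd; natlia.
  have : t (r + d.+1)%N <= t (r + d.+2)%N by apply: tnd; natlia.
  by rewrite /w in xr; move=> *; apply/andP; split; lra.
have EY : energy (t r) (stretch t r.+1 d.+2) = energy w (rcons Y zz).
  rewrite stretchSr addSnnS /Y /zz /w chain_energy_translate // => q.
  rewrite inE => /orP[/eqP->|/mapP[j]]; first by apply: VJ; natlia.
  by rewrite mem_iota => /andP[j1 j2] ->; apply: VJ; natlia.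
have EX : energy (t r) (rcons X' (t (r + d.+2)%N)) = energy w (rcons X zz).
  rewrite -(@chain_energy_translate tau (t r) X').
    by rewrite /X' -map_comp -[in RHS](map_id X); congr (energy _ (rcons _ _));
      apply: eq_map => q /=; rewrite addrK.
  move=> q; rewrite inE => /orP[/eqP->|/mapP[q' q'X ->]]; first by apply: VJ; natlia.
  by rewrite addrK VX.
have EU : stretch t p.+1 d.+1 = rcons X v by rewrite stretchSr addSnnS.
have rr : t r <= t r.+1 by apply: tnd; natlia.
have rdd : t (r + d.+1)%N <= t (r + d.+2)%N by apply: tnd; natlia.
have r1d : t r.+1 <= t (r + d.+1)%N by apply: tnd; natlia.
have exch : energy u (rcons Y v) + energy w (rcons X zz) <=
    energy u (rcons X v) + energy w (rcons Y zz).
  rewrite /X /Y /v /zz; case: (d) c2 c2' rdd r1d => [|d'] c2 c2' rdd r1d.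
    move: c2 c2' rdd; rewrite !addn1 !addn2 => c2 c2' rdd.
    by apply: exchange_nil; rewrite ?lerB // ltW.
  apply: (@exchange_cons u w _ _ (t p.+1) (stretch t p.+2 d') (t r.+1 - tau)
    [seq q - tau | q <- stretch t r.+2 d'.+1]) => //; try exact: ltW.
  by rewrite (last_map (fun q => q - tau)) !last_stretch !addSnnS.
have exch_lt : u < w -> energy u (rcons Y v) + energy w (rcons X zz) <
    energy u (rcons X v) + energy w (rcons Y zz).
  move=> uw; rewrite /X /Y /v /zz; case: (d) c2 c2' rdd r1d => [|d'] c2 c2' rdd r1d.
    move: c2 c2' rdd; rewrite !addn1 !addn2 => c2 c2' rdd.
    by apply: exchange_nil_lt; rewrite ?lerB.
  apply: (@exchange_cons_lt u w _ _ (t p.+1) (stretch t p.+2 d') (t r.+1 - tau)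
    [seq q - tau | q <- stretch t r.+2 d'.+1]) => //; try exact: ltW.
  by rewrite (last_map (fun q => q - tau)) !last_stretch !addSnnS.
have pY s : s <= u -> path <=%R s (rcons Y v).
  move=> su; rewrite rcons_path /Y /= (last_map (fun q => q - tau)) last_stretch addSnnS.
  apply/andP; split; last by rewrite (le_trans _ (ltW c2')) // lerB.
  apply/andP; split; first by rewrite (le_trans su) // (le_trans c1) // lerB.
  apply: (homo_path (f := fun q => q - tau) (e := <=%R)); first by move=> ? ? ?; rewrite lerB.
  by apply: path_stretch => j k ? ?; apply: tnd; natlia.
have pX' : path <=%R (t r) (rcons X' (t (r + d.+2)%N)).
  rewrite rcons_path /X' /X; case: (d) pN c2 rdd r1d => [|d'] pN' c2 rdd r1d /=.
    by rewrite (le_trans rr) // (le_trans r1d).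
  rewrite (last_map (fun q => q + tau)) last_stretch addSnnS -andbA; apply/and3P; split.
  - by move: c1 c1' rr; rewrite /w; olra.
  - apply: (homo_path (f := fun q => q + tau) (e := <=%R));
      first by move=> ? ? ?; rewrite lerD2r.
    by apply: path_stretch => j k ? ?; apply: tnd; natlia.
  - by move: c2 rdd; olra.
have sXY : (size Y + size X' = d + d.+1)%N by rewrite !size_map !size_iota addnC.
have M0 : energy u (rcons X v) + energy w (rcons Y zz) <=
    energy u (rcons Y v) + energy w (rcons X zz).
  rewrite -EX -EY -EU.
  apply: (replace_two_disjoint_pieces tmin) => //; last exact: pY.
  natlia.
(* A strict crossing would lower the energy, so the first crossing takes place at a common point. *)
have uw : u = w.
  apply/eqP; rewrite eq_le c1 leNgt; apply/negP => /exch_lt; move: M0; olra.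
have tbu : t b < u by rewrite uw (lt_le_trans tbx).
have bp' : (b < p)%N.
  by rewrite ltn_neqAle bp andbT; apply/eqP => E; move: tbu; rewrite /u -E ltxx.
have uv : u < t p.+1 by rewrite uw (le_lt_trans _ c1') // lerB.
have pu : t p.-1 < u by apply: (@minimal_segment_no_plateau b p) => //; natlia.
pose y1 := t r.+1 - tau.
(* [K] moves [u] to the right in the given segment, where its successor is [t p.+1]. [L] moves it to
   the left after the exchange, which did not raise the energy, where its successor is
   [y1 < t p.+1]. The two successors make the conditions incompatible. *)
have K : derive1 U (t p.-1 - u) <= derive1 V u + derive1 U (u - t p.+1).
  apply: (site_energy_right_min dU dV uv) => s /andP[s1 s2].
  have := @minimal_segment_site p.-1 s; rewrite !prednK; try natlia.
  by rewrite (le_trans (ltW pu) s1) s2; apply; natlia.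
have L : derive1 V u + derive1 U (u - y1) <= derive1 U (t p.-1 - u).
  apply: (site_energy_left_min dU dV pu) => s /andP[s1 s2].
  have := @replace_two_disjoint_pieces _ _ _ _ tmin p.-1 d.+1 r d.+1 (s :: Y) X'.
  have -> : (p.-1 + d.+2 = p + d.+1)%N by natlia.
  have pA : path <=%R (t p.-1) (rcons (s :: Y) v) by apply/andP; split => //; exact: pY.
  have sA : (size (s :: Y) + size X' = d.+1 + d.+1)%N by rewrite [LHS]addSn sXY addSn.
  rewrite -/v EX EY => M; have {}M := M ltac:(natlia) rN ltac:(natlia) sA pA pX'.
  have E : energy (t p.-1) (stretch t p.-1.+1 d.+2) =
      H (t p.-1) u + energy u (rcons X v).
    by rewrite -EU prednK //; natlia.
  rewrite E in M.
  move: exch M; rewrite /Y /= /FK_energy -/y1 /site_energy; olra.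
have : derive1 U (u - t p.+1) < derive1 U (u - y1).
  by apply: (derive1_homo_lt ddU U2); rewrite /y1; move: c1'; olra.
move: K L; olra.
Qed.

(** The window from [x] to [z] is crossed by [k] steps, hence holds at most [k - 1] of the points
    [b], ..., [b + k]; its translate holds [m + 1] points. The bound thus allows an excess of
    two. *)
Lemma minimal_segment_count tau x z a m b k :
  (forall y, x <= y < z -> V (y + tau) = V y) ->
  (b + k <= N)%N -> (a + m <= N)%N -> (b + k <= a)%N \/ (a + m <= b)%N ->
  t b < x -> z <= t (b + k)%N -> x <= t a - tau -> t (a + m)%N - tau < z ->
  (m <= k)%N.
Proof.
move=> hV bkN amN disj tbx zt xa az; rewrite leqNgt; apply/negP => km.
(* A crossing of the two pieces numbered alike from [b] and [a]. *)
have [|||i [/andP[_ ik] Pi nPi]] :=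
    @exists_last_true (fun i => t (b + i)%N <= t (a + i)%N - tau) 0 k => //.
- by rewrite !addn0; lra.
- have : t (a + k)%N <= t (a + m)%N by apply: tnd; natlia.
  by rewrite -ltNge; lra.
(* A later crossing, with the second piece advanced by one index; the index [k.+1] of that piece is
   still in the window because [k < m]. *)
have [|||j [/andP[ij jk] Qj nQj]] :=
    @exists_last_true (fun i => t (b + i)%N <= t (a + i).+1%N - tau) i k.
- exact: ltnW.
- have : t (a + i)%N <= t (a + i).+1 by apply: tnd; natlia.
  lra.
- have : t (a + k).+1 <= t (a + m)%N by apply: tnd; natlia.
  by rewrite -ltNge; lra.
rewrite -!ltNge !addnS in nPi nQj.
have E1 : (b + i + (j - i) = b + j)%N by natlia.
have E2 : (a + i + (j - i).+1 = (a + j).+1)%N by natlia.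
have E3 : (a + i + (j - i).+2 = (a + j).+2)%N by natlia.
apply: (@minimal_segment_no_double_crossing tau x z b (b + i) (a + i) (j - i) hV);
  rewrite ?E1 ?E2 ?E3 ?addnS ?E1 //; try natlia.
- by have : t a <= t (a + i)%N by [apply: tnd; natlia]; lra.
- by have : t (a + j).+2 <= t (a + m)%N by [apply: tnd; natlia]; lra.
Qed.

End Minimal.
End Aubry.

(** * Gaps, types and recurrence of blocks *)

Section BlockEquiv.
Context {R : realType}.
Variable s : int -> R.

Lemma block_equiv_refl S : block_equiv s S S.
Proof. by split => //; exists 0 => i _; rewrite addr0. Qed.

Lemma block_equiv_sym S T : block_equiv s S T -> block_equiv s T S.
Proof.
move=> [E [tau h]]; split => //; exists (- tau) => i iT.
by rewrite h ?E // addrK.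
Qed.

Lemma block_equiv_trans S T W :
  block_equiv s S T -> block_equiv s T W -> block_equiv s S W.
Proof.
move=> [E [tau h]] [E' [tau' h']]; split; first by rewrite E.
by exists (tau + tau') => i iS; rewrite h' -?E // h // addrA.
Qed.

Lemma block_class_eqP S T : block_class s S = block_class s T <-> block_equiv s S T.
Proof.
split=> [E|ST].
  by rewrite -[block_equiv _ _ _]/(block_class s S T) E; exact: block_equiv_refl.
apply/seteqP; split => W; apply: block_equiv_trans => //.
exact: block_equiv_sym.
Qed.

Lemma block_diam_equiv S T : block_equiv s S T -> block_diam s S = block_diam s T.
Proof. by move=> [E [tau h]]; rewrite /block_diam -E !h //; ring. Qed.

End BlockEquiv.

Lemma finite_set_pos_lower_bound (R : realType) (A : set R) : finite_set A ->
  exists2 g, 0 < g & forall x, A x -> 0 < x -> g <= x.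
Proof.
move=> /finite_seqP[l ->]; elim: l => [|x l [g g0 IH]]; first by exists 1.
have [x0|x0] := ltP 0 x.
  exists (Num.min x g); first by rewrite lt_min x0.
  move=> y /=; rewrite inE => /orP[/eqP->|yl] y0; first by rewrite ge_min lexx.
  by rewrite ge_min IH ?orbT.
exists g => // y /=; rewrite inE => /orP[/eqP->|yl] y0; last exact: IH.
by move: x0; rewrite leNgt y0.
Qed.

Section Quasicrystal.
Context {R : realType}.
Variable s : int -> R.
Hypothesis qs : quasicrystal s.

Lemma points_lt m n : (s m < s n) = (m < n).
Proof.
have [smono _ _ _] := qs.
have [mn|nm|->] := ltgtP m n; first exact: smono.
  by apply/negbTE; rewrite -leNgt ltW // smono.
by rewrite ltxx.
Qed.

Lemma points_le m n : (s m <= s n) = (m <= n).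
Proof. by rewrite leNgt points_lt -leNgt. Qed.

(** Two-point blocks of diameter below 1 form finitely many classes, so gaps below 1 take finitely
    many values. *)
Lemma min_gap : exists2 g : R, 0 < g & forall n, g <= s (n + 1) - s n.
Proof.
have [_ flc _ _] := qs.
have := flc 1 ltr01.
pose F (C : set block) := block_diam s (xget ((0 : int), 0%N) C).
move=> /(finite_image F) /finite_set_pos_lower_bound[g g0 gP].
exists (Num.min g 1); first by rewrite lt_min g0 ltr01.
move=> n; have [h|h] := leP 1 (s (n + 1) - s n); first by rewrite ge_min h orbT.
rewrite ge_min; apply/orP; left; apply: gP; last by rewrite subr_gt0 points_lt; lia.
exists (block_class s (n, 1%N)).
  by exists (n, 1%N) => //; rewrite /= /block_diam /block_point /= addr0.
rewrite /F -(block_diam_equiv (S := (n, 1%N))).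
  by rewrite /block_diam /block_point /= addr0.
have : exists T, block_class s (n, 1%N) T by exists (n, 1%N); exact: block_equiv_refl.
by move=> /(xgetPex ((0 : int), 0%N)).
Qed.

(** Repetitivity of a one-point block puts a point in every ball of some fixed radius. *)
Lemma max_gap : exists2 G : R, 0 < G & forall n, s (n + 1) - s n <= G.
Proof.
have [_ _ rep _] := qs.
have [r [r0 rP]] := rep ((0 : int), 0%N).
exists (2 * r); first by rewrite mulr_gt0.
move=> n; rewrite leNgt; apply/negP => h.
have [T [_ /(_ 0%N isT)]] := rP ((s (n + 1) + s n) / 2).
rewrite /ball /= /block_point addr0 ltr_distl => /andP[h1 h2].
have h3 : s n < s T.1 by lra.
have h4 : s T.1 < s (n + 1) by lra.
by move: h3 h4; rewrite !points_lt; lia.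
Qed.

Lemma points_gap_ge (g : R) : (forall n, g <= s (n + 1) - s n) ->
  forall n (k : nat), g * k%:R <= s (n + k%:Z) - s n.
Proof.
move=> gP n; elim => [|k IH]; first by rewrite mulr0 addr0 subrr.
have := gP (n + k%:Z); rewrite -addrA -natr1 mulrDr mulr1.
by rewrite (_ : (k%:Z + 1 = k.+1%:Z)%R); [lra|lia].
Qed.

Lemma points_gap_le (G : R) : (forall n, s (n + 1) - s n <= G) ->
  forall n (k : nat), s (n + k%:Z) - s n <= G * k%:R.
Proof.
move=> gP n; elim => [|k IH]; first by rewrite mulr0 addr0 subrr.
have := gP (n + k%:Z); rewrite -addrA -natr1 mulrDr mulr1.
by rewrite (_ : (k%:Z + 1 = k.+1%:Z)%R); [lra|lia].
Qed.

Lemma points_floor x : exists m, s m <= x < s (m + 1).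
Proof.
have [g g0 gP] := min_gap.
pose K := Num.bound (`|x - s 0| / g).
have KP : `|x - s 0| < g * K%:R.
  by rewrite [ltRHS]mulrC -ltr_pdivrMr // archi_boundP // divr_ge0 // ltW.
have h1 : s (- K%:Z) <= x.
  have := points_gap_ge gP (- K%:Z) K; rewrite addNr.
  by move/ltr_normlP: KP => [? ?]; lra.
have h2 : x < s (- K%:Z + (2 * K)%N%:Z).
  have := points_gap_ge gP 0 K; rewrite (_ : - K%:Z + (2 * K)%N%:Z = 0 + K%:Z); last lia.
  by move/ltr_normlP: KP => [? ?]; lra.
have [|||j [_ j1 j2]] := @exists_last_true (fun i => s (- K%:Z + i%:Z) <= x) 0 (2 * K).
- by [].
- by rewrite addr0.
- by rewrite -ltNge.
exists (- K%:Z + j%:Z); rewrite j1 /= ltNge -addrA.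
by rewrite (_ : (j%:Z + 1 = j.+1%:Z)%R); [|lia].
Qed.

(** Blocks with [P] gaps have diameter at most [G * P], so finite local complexity covers all
    positions at once; [rep] picks one position in each class. *)
Lemma block_types (P : nat) : exists (rep : int -> int) (reps : seq int),
  [/\ uniq reps, forall n, rep n \in reps, {in reps, forall r, rep r = r}
    & forall n m, rep n = rep m <-> block_equiv s (n, P) (m, P)].
Proof.
have [G G0 GP] := max_gap.
have [_ flc _ _] := qs.
pose h (C : set block) := (xget ((0 : int), 0%N) C).1.
pose rep n := h (block_class s (n, P)).
have repE n : block_equiv s (n, P) (rep n, P).
  have : exists T, block_class s (n, P) T by exists (n, P); exact: block_equiv_refl.
  move=> /(xgetPex ((0 : int), 0%N)).
  rewrite /rep /h; case: (xget _ _) => a b /= [/= E h']; rewrite -E in h'.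
  by split.
have repP n m : rep n = rep m <-> block_equiv s (n, P) (m, P).
  split=> [E|/block_class_eqP E]; last by rewrite /rep E.
  by apply: (block_equiv_trans (repE n)); rewrite E; exact/block_equiv_sym/repE.
have : finite_set (h @` [set block_class s S |
    S in [set S : block | block_diam s S < G * P%:R + 1]]).
  apply: finite_image; apply: flc; rewrite ltr_wpDl // mulr_ge0 // ltW //.
move=> /finite_seqP[l lE].
have repK n : rep (rep n) = rep n by apply/repP; exact/block_equiv_sym/repE.
exists rep, [seq r <- undup l | rep r == r]; split.
- exact/filter_uniq/undup_uniq.
- move=> n; rewrite mem_filter mem_undup repK eqxx /=.
  have : [set` l] (rep n); last by [].
  rewrite -lE; exists (block_class s (n, P)) => //; exists (n, P) => //=.
  rewrite /block_diam /block_point /= addr0.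
  by have := points_gap_le GP n P; lra.
- by move=> r; rewrite mem_filter => /andP[/eqP].
- exact: repP.
Qed.

Lemma block_recurrence1 (P : nat) (n : int) :
  exists K : nat, forall m, exists2 j : nat, (j < K)%N & block_equiv s (n, P) (m + j%:Z, P).
Proof.
have [g g0 gP] := min_gap.
have [_ _ rep _] := qs.
have [r [r0 rP]] := rep (n, P).
pose K := Num.bound (2 * r / g).
have KP : 2 * r < g * K%:R.
  by rewrite [ltRHS]mulrC -ltr_pdivrMr // archi_boundP // divr_ge0 ?mulr_ge0 // ltW.
(* The ball is the interval from [s m] to [s m + 2 * r], so the block found starts after position
   [m] and before [m + K]. *)
exists K => m; have [[a b] [/= ST]] := rP (s m + r).
have E : b = P by case: ST.
rewrite E in ST *; move=> /(_ 0%N isT).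
rewrite /ball /= /block_point /= addr0 ltr_distl => /andP[h1 h2].
have h3 : m < a by rewrite -points_lt; lra.
have h4 : a < m + K%:Z.
  by rewrite -points_lt; have := points_gap_ge gP m K; lra.
exists `|a - m|%N; first lia.
by rewrite (_ : m + `|a - m|%N%:Z = a) //; lia.
Qed.

Lemma block_recurrence (P : nat) :
  exists2 K : nat, (0 < K)%N &
    forall n m, exists2 j : nat, (j < K)%N & block_equiv s (n, P) (m + j%:Z, P).
Proof.
have [rep [reps [_ repin repK repP]]] := block_types P.
suff [K KP] : exists K : nat, forall n, n \in reps -> forall m,
    exists2 j : nat, (j < K)%N & block_equiv s (n, P) (m + j%:Z, P).
  exists K.+1 => // n m; have [j jK nj] := KP _ (repin n) m.
  exists j; first lia.
  by apply: block_equiv_trans nj; apply/repP; rewrite [RHS]repK ?repin.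
elim: {repin repK} reps => [|r l [K KP]]; first by exists 0%N.
have [K' K'P] := block_recurrence1 P r.
exists (K + K')%N => n; rewrite inE => /orP[/eqP->|nl] m.
  by have [j jK ?] := K'P m; exists j => //; lia.
by have [j jK ?] := KP _ nl m; exists j => //; lia.
Qed.

End Quasicrystal.

(** * Frequencies of blocks *)

Section Frequencies.
Context {R : realType}.
Variable s : int -> R.
Hypothesis qs : quasicrystal s.

Lemma local_patch_sub (r tau x : R) (n n' : int) (P : nat) :
  (forall i, (i <= P)%N -> s (n' + i%:Z) = s (n + i%:Z) + tau) ->
  s n + r <= x -> x <= s (n + P%:Z) - r ->
  local_patch s r x `<=` local_patch s r (x + tau).
Proof.
move=> h x1 x2 _ [z [[q _ qz] zb] <-].
move: zb; rewrite -qz /ball /= ltr_distl => /andP[q1 q2].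
have q1' : n < q by rewrite -(points_lt qs); lra.
have q2' : q < n + P%:Z by rewrite -(points_lt qs); lra.
have E : s (n' + `|q - n|%N%:Z) = s q + tau.
  by rewrite h; [congr (s _ + _); lia|lia].
exists (s q + tau); last by ring.
split; first by exists (n' + `|q - n|%N%:Z).
by rewrite /ball /= ltr_distl; apply/andP; split; lra.
Qed.

(** [kappa] gaps are longer than the range, so a margin of [kappa] gaps on both sides determines [V]
    on the core of [p] gaps. The margin does not depend on [p]. *)
Lemma potential_translate (V : R -> R) (r : R) : potential_with_range s r V ->
  exists kappa : nat, forall (p : nat) (n n' : int),
    block_equiv s (n, (kappa + p + kappa)%N) (n', (kappa + p + kappa)%N) ->
  exists tau, (forall i, (i <= p)%N ->
      s (n' + kappa%:Z + i%:Z) = s (n + kappa%:Z + i%:Z) + tau) /\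
    forall y, s (n + kappa%:Z) <= y < s (n + kappa%:Z + p%:Z) -> V (y + tau) = V y.
Proof.
move=> hV; have [g g0 gP] := min_gap qs.
pose K := Num.bound (`|r| / g).
have KP : r < g * K%:R.
  apply: le_lt_trans (ler_norm r) _.
  by rewrite [ltRHS]mulrC -ltr_pdivrMr // archi_boundP // divr_ge0 // ltW.
exists K => p n n' [/= _ [tau h]]; exists tau.
rewrite /block_point /= in h; split.
  by move=> i ip; have := h (K + i)%N ltac:(lia); rewrite PoszD !addrA.
have EP : n + (K + p + K)%N%:Z = n + K%:Z + p%:Z + K%:Z by lia.
move=> y /andP[y1 y2]; apply: hV.
have h1 : s n + r <= y by have := points_gap_ge gP n K; lra.
have h2 : y <= s (n + (K + p + K)%N%:Z) - r.
  by have := points_gap_ge gP (n + K%:Z + p%:Z) K; rewrite EP; lra.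
apply/seteqP; split; last exact: local_patch_sub h h1 h2.
have h' i : (i <= K + p + K)%N -> s (n + i%:Z) = s (n' + i%:Z) + - tau.
  by move=> ip; rewrite h // addrK.
have := local_patch_sub (x := y + tau) h'; rewrite addrK; apply.
  by have := h 0%N isT; rewrite !addr0; lra.
by have := h (K + p + K)%N (leqnn _); lra.
Qed.

Definition type_count (P : nat) (n m : int) (Q : nat) : nat :=
  count (fun i : nat => `[< block_equiv s (n, P) (m + i%:Z, P) >]) (iota 0 Q).

(** The last of the [Q] starting positions is [m + Q - 1], and the block there ends at
    [m + Q + P - 1]. *)
Lemma block_countE P n m Q :
  block_count s (n, P) (s m) (s (m + Q%:Z + P%:Z - 1) - s m) = type_count P n m Q.
Proof.
pose l := [seq ((m + i%:Z : int), P) |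
  i <- iota 0 Q & `[< block_equiv s (n, P) (m + i%:Z, P) >]].
rewrite /block_count (_ : equiv_blocks_in _ _ _ _ = [set` [fset T in l]%fset]).
  rewrite set_fsetK card_fseq undup_id; first by rewrite size_map size_filter.
  rewrite map_inj_uniq ?filter_uniq ?iota_uniq // => i j [].
  by move=> /addrI [].
rewrite /equiv_blocks_in [s m + _]addrC subrK.
apply/seteqP; split => [[a b] [/= ST Tin]|[a b] /=].
  have E : b = P by case: ST.
  rewrite E in ST Tin *.
  have := Tin 0%N isT; have := Tin P (leqnn _).
  rewrite /block_point /= !in_itv /= addr0 !(points_le qs) => /andP[h1 h2] /andP[h3 h4].
  rewrite inE; apply/mapP; exists `|a - m|%N; last by congr (_, _); lia.
  rewrite mem_filter mem_iota; apply/andP; split; last by lia.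
  by apply/asboolP; rewrite (_ : m + `|a - m|%N%:Z = a) //; lia.
rewrite inE => /mapP[i]; rewrite mem_filter mem_iota => /andP[/asboolP ST /andP[_ iQ]] [-> ->].
split => // j /= jP; rewrite /block_point /= in_itv /= !(points_le qs).
by apply/andP; split; lia.
Qed.

Lemma type_count_ge P n m K Q : (0 < K)%N ->
  (forall m', exists2 j : nat, (j < K)%N & block_equiv s (n, P) (m' + j%:Z, P)) ->
  (Q %/ K <= type_count P n m Q)%N.
Proof.
move=> K0 KP.
have H q : (q <= type_count P n m (q * K))%N.
  elim: q => [//|q IH].
  rewrite mulSn addnC /type_count iotaD count_cat -add1n addnC leq_add //.
  rewrite -has_count; apply/hasP.
  have [j jK ?] := KP (m + (q * K)%N%:Z).
  exists (q * K + j)%N; first by rewrite mem_iota; lia.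
  by apply/asboolP; rewrite PoszD addrA.
apply: leq_trans (H _) _.
rewrite /type_count [in leqRHS](divn_eq Q K) iotaD count_cat; lia.
Qed.

(** The uniform limit gives an absolute error; recurrence bounds the frequency from below, which
    makes the error relative. *)
Lemma type_count_ratio P n (e : R) : 0 < e -> exists Q0 : nat,
  forall Q Q' m m', (Q0 <= Q)%N -> (Q0 <= Q')%N ->
  (type_count P n m Q)%:R * (s (m' + Q'%:Z + P%:Z - 1) - s m') <=
  (1 + e) * (type_count P n m' Q')%:R * (s (m + Q%:Z + P%:Z - 1) - s m).
Proof.
move=> e0.
have [g g0 gP] := min_gap qs.
have [G G0 GP] := max_gap qs.
have [K K0 KP] := block_recurrence qs P.
have [_ _ _ freq] := qs.
have [nu nuP] := freq (n, P).
(* A long window has at least [Q / (2 * K)] occurrences and length at most [2 * G * Q], so [c] is a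
   lower bound for the frequency. *)
pose c : R := (4 * K%:R * G)^-1.
have KR : 0 < K%:R :> R by rewrite ltr0n.
have c0 : 0 < c by rewrite invr_gt0 !mulr_gt0.
pose dl := e * c / 2.
have d0 : 0 < dl by rewrite !mulr_gt0 // invr_gt0.
have [M [_ MP]] := nuP _ d0.
pose Q1 := Num.bound (`|M| / g).
have Q1P : M < g * Q1%:R.
  apply: le_lt_trans (ler_norm M) _.
  by rewrite [ltRHS]mulrC -ltr_pdivrMr // archi_boundP // divr_ge0 // ltW.
exists (Q1 + 2 * K + P).+1.
pose len (m : int) (Q : nat) := s (m + Q%:Z + P%:Z - 1) - s m.
pose Q0 := (Q1 + 2 * K + P).+1.
have lenE (m : int) (Q : nat) : (Q0 <= Q)%N -> m + Q%:Z + P%:Z - 1 = m + (Q + P).-1%:Z.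
  by rewrite /Q0; lia.
have lenM m Q : (Q0 <= Q)%N -> M < len m Q.
  move=> QQ; rewrite /len lenE //; apply: lt_le_trans Q1P _.
  apply: le_trans (points_gap_ge gP _ _); rewrite ler_pM2l // ler_nat.
  by move: QQ; rewrite /Q0; lia.
have len0 m Q : (Q0 <= Q)%N -> 0 < len m Q.
  by move=> QQ; rewrite /len subr_gt0 (points_lt qs); move: QQ; rewrite /Q0; lia.
have lenG m Q : (Q0 <= Q)%N -> len m Q <= 2 * G * Q%:R.
  move=> QQ; rewrite /len lenE //; apply: le_trans (points_gap_le GP _ _) _.
  rewrite (mulrC 2) -mulrA ler_pM2l // -natrM ler_nat.
  by move: QQ; rewrite /Q0; lia.
have nuE m Q : (Q0 <= Q)%N -> `|(type_count P n m Q)%:R / len m Q - nu| < dl.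
  by move=> QQ; rewrite -block_countE; apply: MP; exact: lenM.
have cP m Q : (Q0 <= Q)%N -> c <= (type_count P n m Q)%:R / len m Q.
  move=> QQ; rewrite ler_pdivlMr ?len0 //.
  apply: (@le_trans _ _ (c * (2 * G * Q%:R))); first by rewrite ler_pM2l // lenG.
  have -> : c * (2 * G * Q%:R) = Q%:R / (2 * K%:R).
    by rewrite /c; field; rewrite !gt_eqF.
  rewrite ler_pdivrMr; last by rewrite mulr_gt0.
  rewrite -!natrM ler_nat.
  have := @type_count_ge P n m K Q K0 (KP n).
  have := divn_eq Q K; have := ltn_pmod Q K0.
  have : (1 <= Q %/ K)%N by rewrite divn_gt0 //; move: QQ; rewrite /Q0; lia.
  move: (Q %/ K)%N (Q %% K)%N (type_count _ _ _ _) => a b t'; clear.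
  nia.
move=> Q Q' m m' QQ QQ'; rewrite -[s _ - s m']/(len m' Q') -[s _ - s m]/(len m Q).
have h1 := nuE m Q QQ; have h2 := nuE m' Q' QQ'; have h3 := cP m' Q' QQ'.
rewrite -ler_pdivlMr ?len0 // mulrAC -ler_pdivrMr ?len0 // -mulrA.
set a := _ / len m Q in h1 *; set b := _ / len m' Q' in h2 h3 *.
rewrite mulrDl mul1r.
have : e * c <= e * b by rewrite ler_pM2l.
have : 2 * dl = e * c by rewrite /dl; field.
by move: h1 h2 => /ltr_normlP[? ?] /ltr_normlP[? ?]; lra.
Qed.

End Frequencies.

Section WeightedFrequencies.
Context {R : realType}.
Variable s : int -> R.
Hypothesis qs : quasicrystal s.

(** The sum is split by class. [Q0] is chosen before [w], since the weight will depend on the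
    minimal segment. *)
Lemma weighted_count_ratio P (e : R) : 0 < e -> exists Q0 : nat,
  forall w : int -> nat,
  (forall n m, block_equiv s (n, P) (m, P) -> w n = w m) ->
  forall Q Q' m m', (Q0 <= Q)%N -> (Q0 <= Q')%N ->
  (\sum_(0 <= i < Q) w (m + i%:Z)%R)%:R * (s (m' + Q'%:Z + P%:Z - 1) - s m') <=
  (1 + e) * (\sum_(0 <= i < Q') w (m' + i%:Z)%R)%:R *
    (s (m + Q%:Z + P%:Z - 1) - s m).
Proof.
move=> e0; have [rep [reps [ureps repin repK repP]]] := block_types qs P.
have [Q0 Q0P] : exists Q0 : nat, forall n, n \in reps ->
  forall Q Q' m m', (Q0 <= Q)%N -> (Q0 <= Q')%N ->
  (type_count s P n m Q)%:R * (s (m' + Q'%:Z + P%:Z - 1) - s m') <=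
  (1 + e) * (type_count s P n m' Q')%:R * (s (m + Q%:Z + P%:Z - 1) - s m).
  elim: {repin ureps repK} reps => [|r l [Q1 IH]]; first by exists 0%N.
  have [Q2 Q2P] := type_count_ratio qs P r e0.
  exists (Q1 + Q2)%N => n; rewrite inE => /orP[/eqP->|nl] Q Q' m m' h h'.
    by apply: Q2P; lia.
  by apply: IH => //; lia.
exists Q0 => w wP Q Q' m m' QQ QQ'.
have sumE q j : (\sum_(0 <= i < q) w (j + i%:Z)%R =
    \sum_(r <- reps) w r * type_count s P r j q)%N.
  transitivity (\sum_(0 <= i < q) \sum_(r <- reps) w r * (rep (j + i%:Z)%R == r))%N.
    apply: eq_bigr => i _; rewrite (bigD1_seq (rep (j + i%:Z))) //= eqxx muln1.
    rewrite big1 ?addn0; last by move=> r; rewrite eq_sym => /negbTE ->; rewrite muln0.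
    by apply: wP; apply/repP; rewrite [RHS]repK ?repin.
  rewrite exchange_big /=; apply: eq_big_seq => r rin; rewrite -big_distrr /=.
  congr muln; rewrite /type_count -sum1_count [RHS]big_mkcond /= /index_iota subn0.
  apply: eq_bigr => i _; have rr := repK _ rin.
  case: eqP => E; case: asboolP => // B; exfalso.
    by apply: B; apply/repP; rewrite rr E.
  by apply: E; move/repP: B; rewrite rr.
rewrite !sumE !natr_sum mulr_suml mulr_sumr mulr_suml.
rewrite big_seq [leRHS]big_seq; apply: ler_sum => r rin; rewrite !natrM.
rewrite [leRHS](_ : _ = (w r)%:R * ((1 + e) * (type_count s P r m' Q')%:R *
  (s (m + Q%:Z + P%:Z - 1) - s m))); last by ring.
by rewrite -mulrA ler_wpM2l // Q0P.
Qed.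

End WeightedFrequencies.

(** * Counting the points of a segment to the left of a quasicrystal point *)

Section Rank.
Context {R : realType}.
Variable s : int -> R.
Hypothesis qs : quasicrystal s.
Variables (N : nat) (t : nat -> R).
Hypothesis tnd : nondecreasing_upto N t.

(* The number of indices [q <= N] with [t q < s m]. *)
Definition rank (m : int) : nat := find (fun q => s m <= t q) (iota 0 N.+1).

Lemma rank_le m : (rank m <= N.+1)%N.
Proof. by rewrite -[leqRHS](size_iota 0) find_size. Qed.

Lemma lt_rank m q : (q < rank m)%N -> t q < s m.
Proof.
move=> qm; have := rank_le m => mN.
by have := before_find 0%N qm; rewrite nth_iota ?add0n 1?ltNge ?(leq_trans qm) // => ->.
Qed.

Lemma rank_ge m q : (rank m <= q)%N -> (q <= N)%N -> s m <= t q.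
Proof.
move=> mq qN; apply: (@le_trans _ _ (t (rank m))); last first.
  by apply: tnd; rewrite mq.
have h : has (fun q => s m <= t q) (iota 0 N.+1).
  by rewrite has_find size_iota -/(rank m); lia.
by have := nth_find 0%N h; rewrite -/(rank m) nth_iota ?add0n //; lia.
Qed.

Lemma rank_homo m m' : m <= m' -> (rank m <= rank m')%N.
Proof.
move=> mm; rewrite leqNgt; apply/negP => h.
have h1 := lt_rank h; have h2 := rank_ge (leqnn (rank m')) ltac:(have := rank_le m; lia).
by move: mm; rewrite -(points_le qs); lra.
Qed.

(** The counts over overlapping windows of [p] gaps telescope, leaving [p] ranks at each end. The
    additive form avoids truncated subtraction of sums. *)
Lemma rank_telescope (p : nat) m Q :
  (\sum_(0 <= i < Q) (rank (m + i%:Z + p%:Z)%R - rank (m + i%:Z)%R) +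
    \sum_(0 <= i < p) rank (m + i%:Z)%R = \sum_(0 <= i < p) rank (m + Q%:Z + i%:Z)%R)%N.
Proof.
elim: Q => [|Q IH].
  by rewrite big_geq // add0n; apply: eq_bigr => i _; rewrite addr0.
rewrite big_nat_recr //= addnAC IH.
have : (rank (m + Q%:Z)%R + \sum_(0 <= i < p) rank (m + Q.+1%:Z + i%:Z)%R =
   \sum_(0 <= i < p) rank (m + Q%:Z + i%:Z)%R + rank (m + Q%:Z + p%:Z)%R)%N.
  rewrite -[RHS](@big_nat_recr _ _ _ _ _ (fun i => rank (m + Q%:Z + i%:Z))) //.
  rewrite big_nat_recl // addr0; congr addn; apply: eq_bigr => i _.
  by congr rank; lia.
have : (rank (m + Q%:Z)%R <= rank (m + Q%:Z + p%:Z)%R)%N by apply: rank_homo; lia.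
move: (\sum_(_ <= _ < _) _)%N (\sum_(_ <= _ < _) _)%N; lia.
Qed.

End Rank.

(** * Counts of points in equivalent patterns *)

Section DensityComparison.
Context {R : realType}.
Variables (s : int -> R) (U V : R -> R).
Hypothesis qs : quasicrystal s.
Hypothesis hV : short_range_potential s V.
Hypothesis dU : forall x, derivable U x 1.
Hypothesis ddU : forall x, derivable U^`() x 1.
Hypothesis U2 : forall x, 0 < U^`(2) x.
Hypothesis dV : forall x, derivable V x 1.

Local Notation H := (FK_energy U V).

Definition core_count N t (p : nat) (m : int) : nat :=
  (rank s N t (m + p%:Z)%R - rank s N t m)%N.

(** The two rank conditions say that the segment has a point strictly before the core at [n'] and
    one at or beyond its right end, that is, it crosses this core. The core at [n] need not be
    crossed. *)
Lemma core_count_compare : exists kappa : nat, forall (p : nat) N t (n n' : int),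
  minimal_segment H N t ->
  block_equiv s (n', (kappa + p + kappa)%N) (n, (kappa + p + kappa)%N) ->
  n + p%:Z <= n' \/ n' + p%:Z <= n ->
  (0 < rank s N t (n' + kappa%:Z))%N -> (rank s N t (n' + kappa%:Z + p%:Z) <= N)%N ->
  (core_count N t p (n + kappa%:Z) <= core_count N t p (n' + kappa%:Z) + 2)%N.
Proof.
have [r [r0 rV]] := hV.
have [kappa kP] := potential_translate qs rV.
exists kappa => p N t n n' tmin /kP[tau [tauE tauV]] disj b0 b1.
have tnd := tmin.1; rewrite /core_count.
have [|a01] := leqP (rank s N t (n + kappa%:Z + p%:Z)) (rank s N t (n + kappa%:Z)).
  by rewrite -subn_eq0 => /eqP ->.
have aN := rank_le s N t (n + kappa%:Z + p%:Z).
have b01 : (rank s N t (n' + kappa%:Z) <= rank s N t (n' + kappa%:Z + p%:Z))%N.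
  by apply: (rank_homo qs tnd); lia.
set a0 := rank s N t (n + kappa%:Z) in a01 *.
set a1 := rank s N t (n + kappa%:Z + p%:Z) in a01 aN *.
have t0 := tauE 0%N isT; rewrite !addr0 in t0.
have tp := tauE p (leqnn _).
have h1 : s (n + kappa%:Z) <= t a0 by apply: (rank_ge tnd); lia.
have h2 : t a1.-1 < s (n + kappa%:Z + p%:Z) by apply: (@lt_rank _ s N); lia.
have h3 : t (rank s N t (n' + kappa%:Z)).-1 < s (n' + kappa%:Z).
  by apply: (@lt_rank _ s N); lia.
have h4 : s (n' + kappa%:Z + p%:Z) <= t (rank s N t (n' + kappa%:Z + p%:Z)).
  exact: (rank_ge tnd).
have E1 : (a0 + (a1.-1 - a0) = a1.-1)%N by lia.
have dj : (rank s N t (n' + kappa%:Z + p%:Z) <= a0)%N \/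
    (a1 <= rank s N t (n' + kappa%:Z))%N.
  by case: disj => [d|d]; [right|left]; apply: (rank_homo qs tnd); lia.
set q0 := rank s N t (n' + kappa%:Z) in b0 b01 h3 dj *.
set q1 := rank s N t (n' + kappa%:Z + p%:Z) in b1 b01 h4 dj *.
have E2 : (q0.-1 + (q1 - q0).+1 = q1)%N by lia.
have := @minimal_segment_count _ U V dU ddU U2 dV N t tmin tau _ _ a0 (a1.-1 - a0)
  q0.-1 (q1 - q0).+1 tauV.
rewrite E1 E2 => /(_ b1 ltac:(natlia) ltac:(natlia) h3 h4).
move=> /(_ ltac:(move: h1 t0; olra) ltac:(move: h2 tp; olra)); natlia.
Qed.

(** Overlapping cores are compared through a third occurrence disjoint from both, at a cost of two
    points each time. *)
Lemma core_count_window : exists kappa : nat, forall p : nat, exists Q0 : nat,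
  forall N t, minimal_segment H N t ->
  forall m Q, (Q0 <= Q)%N -> (0 < rank s N t (m + kappa%:Z))%N ->
    (rank s N t (m + kappa%:Z + Q%:Z + p%:Z) <= N)%N ->
  forall n (i : nat), (i <= Q)%N ->
    block_equiv s (n, (kappa + p + kappa)%N) (m + i%:Z, (kappa + p + kappa)%N) ->
  (core_count N t p (n + kappa%:Z) <= core_count N t p (m + kappa%:Z + i%:Z) + 4)%N.
Proof.
have [kappa kP] := core_count_compare.
exists kappa => p; have [K K0 KP] := block_recurrence qs (kappa + p + kappa).
exists (3 * K + 6 * p)%N => N t tmin m Q QQ m0 mQ n i iQ ni.
have tnd := tmin.1.
have [n2 [[i2 i2Q n2E] nn2 d1 d2]] : exists n2,
  [/\ exists2 i2 : nat, (i2 <= Q)%N & n2 = m + i2%:Z,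
    block_equiv s (n, (kappa + p + kappa)%N) (n2, (kappa + p + kappa)%N),
    n + p%:Z <= n2 \/ n2 + p%:Z <= n & m + i%:Z + p%:Z <= n2 \/ n2 + p%:Z <= m + i%:Z].
  have [j0 j0K e0] := KP n m.
  have [j1 j1K e1] := KP n (m + (K + 2 * p)%N%:Z).
  have [j2 j2K e2] := KP n (m + (2 * K + 4 * p)%N%:Z).
  (* The three candidates are more than [2 * p] positions apart, so each of the two given cores
     overlaps at most one of them, and one candidate remains. *)
  pose ok (x : int) := (n + p%:Z <= x) || (x + p%:Z <= n) .
  pose ok' (x : int) := (m + i%:Z + p%:Z <= x) || (x + p%:Z <= m + i%:Z).
  have [/andP[/orP o /orP o']|h0] := boolP (ok (m + j0%:Z) && ok' (m + j0%:Z)).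
    by exists (m + j0%:Z); split => //; exists j0 => //; lia.
  have [/andP[/orP o /orP o']|h1] := boolP (ok (m + (K + 2 * p)%N%:Z + j1%:Z) &&
      ok' (m + (K + 2 * p)%N%:Z + j1%:Z)).
    exists (m + (K + 2 * p)%N%:Z + j1%:Z); split => //.
    by exists (K + 2 * p + j1)%N; lia.
  exists (m + (2 * K + 4 * p)%N%:Z + j2%:Z); split => //.
  - by exists (2 * K + 4 * p + j2)%N; lia.
  - by move: h0 h1; rewrite /ok /ok'; clear -iQ QQ j0K j1K j2K; lia.
  - by move: h0 h1; rewrite /ok /ok'; clear -iQ QQ j0K j1K j2K; lia.
have cross (j : nat) : (j <= Q)%N -> (0 < rank s N t (m + j%:Z + kappa%:Z))%N /\
    (rank s N t (m + j%:Z + kappa%:Z + p%:Z) <= N)%N.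
  move=> jQ; split.
    by apply: leq_trans m0 _; apply: (rank_homo qs tnd); lia.
  by apply: leq_trans _ mQ; apply: (rank_homo qs tnd); lia.
have [c1 c2] := cross _ i2Q; have [c3 c4] := cross _ iQ.
rewrite n2E in d1 d2 nn2.
have A1 := kP p N t n (m + i2%:Z) tmin (block_equiv_sym nn2) d1 c1 c2.
have A2 := kP p N t (m + i2%:Z) (m + i%:Z) tmin
  (block_equiv_trans (block_equiv_sym ni) nn2) ltac:(clear -d2; lia) c3 c4.
rewrite (_ : m + kappa%:Z + i%:Z = m + i%:Z + kappa%:Z); last by lia.
by move: A1 A2; clear; lia.
Qed.

End DensityComparison.

(** * Density of minimal segments *)



Section DensityBound.
Context {R : realType}.
Variables (s : int -> R) (U V : R -> R).
Hypothesis qs : quasicrystal s.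
Hypothesis hV : short_range_potential s V.
Hypothesis dU : forall x, derivable U x 1.
Hypothesis ddU : forall x, derivable U^`() x 1.
Hypothesis U2 : forall x, 0 < U^`(2) x.
Hypothesis dV : forall x, derivable V x 1.

Local Notation H := (FK_energy U V).

(** [w] is the minimum of [D] over the occurrences of a class in the reference window. It is below
    [D] there, and being attained it can also be compared with counts elsewhere. *)
Lemma core_count_equiv_min (P Q : nat) (D : nat -> nat) (m : int) :
  (exists Q1, (Q1 <= Q)%N /\ forall n, exists2 j : nat, (j < Q1)%N &
     block_equiv s (n, P) (m + j%:Z, P)) ->
  exists w : int -> nat,
    [/\ forall n n', block_equiv s (n, P) (n', P) -> w n = w n',
        forall i : nat, (i < Q)%N -> (w (m + i%:Z)%R <= D i)%N
      & forall n, exists i : nat, [/\ (i < Q)%N, w n = D i &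
          block_equiv s (n, P) (m + i%:Z, P)]].
Proof.
move=> [Q1 [Q1Q hQ1]]; have [rep [reps [_ repin repK repP]]] := block_types qs P.
have ex n : exists v : nat, (exists i : nat, [/\ (i < Q)%N, v = D i &
      block_equiv s (n, P) (m + i%:Z, P)]) /\
    forall i : nat, (i < Q)%N -> block_equiv s (n, P) (m + i%:Z, P) -> (v <= D i)%N.
  pose pr (v : nat) := `[< exists i : nat, [/\ (i < Q)%N, v = D i &
      block_equiv s (n, P) (m + i%:Z, P)] >].
  have exv : exists v, pr v.
    have [j jQ nj] := hQ1 n; exists (D j); apply/asboolP; exists j; split => //.
    exact: leq_trans jQ _.
  have [v /asboolP vP vmin] := ex_minnP exv.
  exists v; split => // i iQ ni; apply: vmin; apply/asboolP; by exists i.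
have [f fP] := choice ex.
have repE n : block_equiv s (rep n, P) (n, P).
  by apply/repP; rewrite repK ?repin.
exists (fun n => f (rep n)); split.
- by move=> n n' /repP ->.
- by move=> i iQ; apply: (fP _).2.
- move=> n; have [[i [iQ -> ri]] _] := fP (rep n); exists i; split => //.
  exact: block_equiv_trans (block_equiv_sym (repE n)) ri.
Qed.

Lemma rank_density_compare (e : R) : 0 < e -> exists Q0 : nat,
  forall N t, minimal_segment H N t ->
  forall m1 m2 m3 m4 : int, m1 + Q0%:Z <= m2 -> m3 + Q0%:Z <= m4 ->
    (0 < rank s N t m3)%N -> (rank s N t m4 <= N)%N ->
  (rank s N t m2 - rank s N t m1)%:R * (s m4 - s m3) <=
  (1 + e) * (rank s N t m4 - rank s N t m3)%:R * (s m2 - s m1) +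
    e * ((s m2 - s m1) * (s m4 - s m3)).
Proof.
move=> e0; have [g g0 gP] := min_gap qs; have [G G0 GP] := max_gap qs.
(* An error of 4 at each of at most [2 * |m2 - m1|] positions is at most [8 / g] per unit length;
   division by [p] brings it below [e]. *)
pose p := (Num.bound (8 / (g * e))).+1.
have pP : 8 / g <= e * p%:R.
  rewrite ler_pdivrMr // mulrAC mulrC -ler_pdivrMr ?mulr_gt0 // (mulrC e).
  apply: ltW; apply: (@lt_le_trans _ _ (Num.bound (8 / (g * e)))%:R).
    by rewrite archi_boundP // divr_ge0 // mulr_ge0 // ltW.
  by rewrite ler_nat /p.
have p0 : (0 < p)%N by [].
(* Chosen so that [(1 + dl) ^ 2 <= 1 + e]: one factor for the frequencies, one for the margins
   around the first window. *)
pose dl := Num.min 1 e / 3.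
have d0 : 0 < dl by rewrite divr_gt0 // lt_min ltr01.
have dl1 : dl <= 1 / 3 by rewrite ler_pM2r ?invr_gt0 // ge_min lexx.
have dle : dl <= e / 3 by rewrite ler_pM2r ?invr_gt0 // ge_min lexx orbT.
have [kappa kP] := core_count_window qs hV dU ddU U2 dV.
have [Q1 Q1P] := kP p.
pose P := (kappa + p + kappa)%N.
have [Q2 Q2P] := weighted_count_ratio qs P d0.
have [Q3 Q30 Q3P] := block_recurrence qs P.
(* Over [Q4] gaps the margins are a fraction at most [dl] of the length. *)
pose Q4 := Num.bound (G * (2 * P)%:R / (dl * g)).
have Q4P : G * (2 * P)%:R <= dl * (g * Q4%:R).
  rewrite mulrA [leRHS]mulrC -ler_pdivrMr; last exact: mulr_gt0.
  apply: ltW.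
  apply: archi_boundP; apply: divr_ge0; last exact: (mulr_ge0 (ltW d0) (ltW g0)).
  exact: (mulr_ge0 (ltW G0) (ler0n _ _)).
exists (Q1 + Q2 + Q3 + Q4 + p)%N => N t tmin m1 m2 m3 m4 m12 m34 r3 r4.
have tnd := tmin.1.
pose c m := rank s N t m.
have cmono m m' : m <= m' -> (c m <= c m')%N by exact: (rank_homo qs tnd).
(* [QI] counts the cores starting from [m1 - p] to [m2 - 1], which cover each gap of the first
   window [p] times; [QJ] counts the cores contained in the second, which cover each gap at most [p]
   times. *)
pose QI := (`|m2 - m1| + p)%N; pose QJ := (`|m4 - m3| - p).+1.
have QIE : m1 - p%:Z + QI%:Z = m2 by rewrite /QI; ilia.
have QJE : m3 + QJ%:Z = m4 - p%:Z + 1 by rewrite /QJ; ilia.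
pose m := m3 - kappa%:Z.
have mE : m + kappa%:Z = m3 by rewrite /m subrK.
have [w [wP wmin wex]] : exists w : int -> nat,
    [/\ forall n n', block_equiv s (n, P) (n', P) -> w n = w n',
        forall i : nat, (i < QJ)%N -> (w (m + i%:Z)%R <= core_count s N t p (m3 + i%:Z)%R)%N
      & forall n, exists i : nat, [/\ (i < QJ)%N, w n = core_count s N t p (m3 + i%:Z) &
          block_equiv s (n, P) (m + i%:Z, P)]].
  apply: core_count_equiv_min; exists Q3; split; last by move=> n; apply: Q3P.
  by rewrite /QJ; ilia.
pose m' := m1 - p%:Z - kappa%:Z.
have up : (p * (c m2 - c m1) <= \sum_(0 <= i < QI) w (m' + i%:Z)%R + 4 * QI)%N.
  have T := rank_telescope qs tnd p (m1 - p%:Z) QI.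
  rewrite QIE in T.
  have lo : (p * c m2 <= \sum_(0 <= i < p) rank s N t (m2 + i%:Z)%R)%N.
    rewrite -[p in leqLHS]subn0 -sum_nat_const_nat; apply: leq_sum => i _.
    by apply: cmono; ilia.
  have hi : (\sum_(0 <= i < p) rank s N t (m1 - p%:Z + i%:Z)%R <= p * c m1)%N.
    rewrite -[p in leqRHS]subn0 -sum_nat_const_nat [leqLHS]big_nat [leqRHS]big_nat.
    by apply: leq_sum => i ip; apply: cmono; ilia.
  have le4 : (\sum_(0 <= i < QI) (rank s N t (m1 - p%:Z + i%:Z + p%:Z)%R -
      rank s N t (m1 - p%:Z + i%:Z)%R) <=
      \sum_(0 <= i < QI) (w (m' + i%:Z)%R + 4))%N.
    apply: leq_sum => i _; have [j [jQ -> nj]] := wex (m' + i%:Z).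
    have := @Q1P N t tmin m QJ.-1; rewrite mE.
    move=> /(_ ltac:(rewrite /QJ; ilia) r3).
    have hr : (rank s N t (m3 + QJ.-1%:Z + p%:Z) <= N)%N.
      by apply: leq_trans r4; apply: cmono; rewrite /QJ; ilia.
    move=> /(_ hr (m' + i%:Z) j ltac:(clear -jQ; lia) nj).
    rewrite /core_count (_ : m' + i%:Z + kappa%:Z = m1 - p%:Z + i%:Z) //.
    by rewrite /m'; ilia.
  rewrite big_split /= sum_nat_const_nat subn0 in le4.
  rewrite mulnBr; move: lo hi le4 T; rewrite -/(c m2) -/(c m1).
  by move: (\sum_(0 <= i < QI) w _)%N => W; clear; lia.
have dn : (\sum_(0 <= i < QJ) w (m + i%:Z)%R <= p * (c m4 - c m3))%N.
  have T := rank_telescope qs tnd p m3 QJ.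
  have lo : (p * c m3 <= \sum_(0 <= i < p) rank s N t (m3 + i%:Z)%R)%N.
    rewrite -[p in leqLHS]subn0 -sum_nat_const_nat; apply: leq_sum => i _.
    by apply: cmono; ilia.
  have hi : (\sum_(0 <= i < p) rank s N t (m3 + QJ%:Z + i%:Z)%R <= p * c m4)%N.
    rewrite -[p in leqRHS]subn0 -sum_nat_const_nat [leqLHS]big_nat [leqRHS]big_nat.
    by apply: leq_sum => i ip; apply: cmono; rewrite QJE; ilia.
  have le0 : (\sum_(0 <= i < QJ) w (m + i%:Z)%R <=
      \sum_(0 <= i < QJ) (rank s N t (m3 + i%:Z + p%:Z)%R - rank s N t (m3 + i%:Z)%R))%N.
    by rewrite [leqLHS]big_nat [leqRHS]big_nat; apply: leq_sum => i iQ; apply: wmin.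
  rewrite mulnBr; move: lo hi le0 T; move: (\sum_(0 <= i < QJ) w _)%N => W.
  by clear; lia.
have ratio := Q2P w wP QI QJ m' m ltac:(rewrite /QI; ilia) ltac:(rewrite /QJ; ilia).
have EI : m' + QI%:Z + P%:Z - 1 = m2 + (kappa + p).-1%:Z.
  by rewrite /m' /QI /P; ilia.
have EJ : m + QJ%:Z + P%:Z - 1 = m4 + kappa%:Z by rewrite /m /QJ /P; ilia.
rewrite EI EJ in ratio.
set W1 := (\sum_(0 <= i < QI) _)%N in up ratio.
set W2 := (\sum_(0 <= i < QJ) _)%N in dn ratio.
set A := s m2 - s m1; set B := s m4 - s m3.

have a0 : (Q4 + p <= `|m2 - m1|)%N by ilia.
have Aa : g * `|m2 - m1|%N%:R <= A.
  by have := points_gap_ge gP m1 `|m2 - m1|%N; rewrite (_ : m1 + _ = m2) //; ilia.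
have lenI : s (m2 + (kappa + p).-1%:Z) - s m' <= (1 + dl) * A.
  have h1 := points_gap_le GP m2 (kappa + p).-1.
  have h2 := points_gap_le GP m' (p + kappa).
  rewrite (_ : m' + (p + kappa)%N%:Z = m1) in h2; last by rewrite /m'; ilia.
  have h3 : G * (kappa + p).-1%:R + G * (p + kappa)%:R <= G * (2 * P)%:R.
    by rewrite -mulrDr -natrD ler_pM2l // ler_nat /P; ilia.
  have h4 : dl * (g * Q4%:R) <= dl * A.
    rewrite ler_pM2l //; apply: le_trans Aa.
    by rewrite ler_pM2l // ler_nat; ilia.
  rewrite mulrDl mul1r; move: h1 h2 h3 h4 Q4P; rewrite /A.
  by olra.
have lenJ : B <= s (m4 + kappa%:Z) - s m.
  by rewrite /B lerB // (points_le qs) /m; ilia.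
have B0 : 0 <= B by rewrite /B subr_ge0 (points_le qs); ilia.
have A0 : 0 <= A by rewrite /A subr_ge0 (points_le qs); ilia.
rewrite -/(c m1) -/(c m2) -/(c m3) -/(c m4).
set x := (c m2 - c m1)%N in up *; set y := (c m4 - c m3)%N in dn *.
have upR : p%:R * x%:R <= W1%:R + e * p%:R * A.
  have : p%:R * x%:R <= W1%:R + 4 * QI%:R :> R.
    by rewrite -!natrM -natrD ler_nat.
  move=> h; apply: le_trans h _; rewrite lerD2l.
  apply: (@le_trans _ _ (8 * `|m2 - m1|%N%:R)).
    by rewrite -!natrM ler_nat /QI; ilia.
  apply: (@le_trans _ _ (8 / g * A)); last by rewrite ler_wpM2r.
  by rewrite -mulrA ler_pM2l // mulrC ler_pdivlMr // mulrC.
have dnR : W2%:R <= p%:R * y%:R :> R by rewrite -natrM ler_nat.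
have WB : W1%:R * B <= (1 + e) * (p%:R * y%:R) * A.
  apply: (@le_trans _ _ (W1%:R * (s (m4 + kappa%:Z) - s m))); first by rewrite ler_wpM2l.
  apply: (le_trans ratio).
  apply: (@le_trans _ _ ((1 + dl) * W2%:R * ((1 + dl) * A))).
    by rewrite ler_wpM2l // mulr_ge0 // addr_ge0 // ltW.
  apply: (@le_trans _ _ ((1 + dl) * (1 + dl) * A * (p%:R * y%:R))).
    rewrite (_ : _ * (_ * A) = (1 + dl) * (1 + dl) * A * W2%:R); last by ring.
    by rewrite ler_wpM2l // !mulr_ge0 // addr_ge0 // ltW.
  rewrite [leRHS](_ : _ = (1 + e) * (A * (p%:R * y%:R))); last by ring.
  rewrite -mulrA ler_wpM2r ?mulr_ge0 //.
  have : dl * dl <= dl * (1 / 3) by rewrite ler_pM2l.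
  by move: dle d0; olra.
have pR : 0 < p%:R :> R by rewrite ltr0n.
rewrite -(ler_pM2l pR).
have h : p%:R * x%:R * B <= (W1%:R + e * p%:R * A) * B by rewrite ler_wpM2r.
by move: h WB; olra.
Qed.

End DensityBound.

(* The segment has to cross the second window, but it may start or end inside the
   first one; [M] does not depend on the segment. *)
Definition uniform_density (R : realType) (H : R -> R -> R) : Prop :=
  forall e : R, 0 < e -> exists2 M : R, 0 < M &
  forall N t, minimal_segment H N t ->
  forall (i j k l : nat) (x L y L' : R), (i <= j <= N)%N -> (k <= l <= N)%N ->
    M <= L -> M <= L' -> x <= t i -> t j <= x + L -> t k <= y -> y + L' <= t l ->
  (j - i)%:R * L' <= (1 + e) * (l - k)%:R * L + e * (L * L').

(* Six consecutive points close together force points everywhere, because their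
   pattern recurs and the counts of points in two copies of it differ by at most
   four. *)
Definition uniform_jump_bound (R : realType) (H : R -> R -> R) : Prop :=
  forall L0 : R, exists2 K : R, 0 < K &
  forall N t, minimal_segment H N t ->
  forall i, (i + 5 <= N)%N -> t (i + 5)%N - t i <= L0 ->
  forall k, (k < N)%N -> t k.+1 - t k <= K.

(** * From windows of the quasicrystal to arbitrary intervals *)

Section WindowDensity.
Context {R : realType}.
Variables (s : int -> R) (U V : R -> R).
Hypothesis qs : quasicrystal s.
Hypothesis hV : short_range_potential s V.
Hypothesis dU : forall x, derivable U x 1.
Hypothesis ddU : forall x, derivable U^`() x 1.
Hypothesis U2 : forall x, 0 < U^`(2) x.
Hypothesis dV : forall x, derivable V x 1.

Local Notation H := (FK_energy U V).

Lemma rank_gtP N t m q : nondecreasing_upto N t -> (q <= N)%N ->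
  (q < rank s N t m)%N = (t q < s m).
Proof.
move=> tnd qN; have [h|h] := ltnP q (rank s N t m); first by rewrite (lt_rank h).
by symmetry; apply/negbTE; rewrite -leNgt (rank_ge tnd).
Qed.

Lemma window_density : uniform_density H.
Proof.
move=> e e0; have [G G0 GP] := max_gap qs.
(* The factor 7 gives [(1 + e1) ^ 3 <= 1 + 7 * e1 <= 1 + e]. *)
pose e1 := Num.min 1 e / 7.
have e10 : 0 < e1 by rewrite divr_gt0 // lt_min ltr01.
have e1l : e1 <= 1 / 7 by rewrite ler_pM2r ?invr_gt0 // ge_min lexx.
have e1e : e1 <= e / 7 by rewrite ler_pM2r ?invr_gt0 // ge_min lexx orbT.
have [Q0 Q0P] := rank_density_compare qs hV dU ddU U2 dV e10.
(* Rounding changes a length by at most [2 * G], which is a fraction at most [e1] of any length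
   above [M1]. *)
pose M1 := 2 * G * (1 + e1) / e1.
have f0 : 0 <= 1 + e1 by rewrite addr_ge0 // ltW.
have M10 : 0 <= M1.
  by apply: divr_ge0 (ltW e10); apply: mulr_ge0 f0; exact: (mulr_ge0 _ (ltW G0)).
have M1E : M1 * e1 = 2 * G * (1 + e1) by rewrite /M1 divfK // gt_eqF.
have GQ : 0 <= G * Q0%:R by rewrite mulr_ge0 // ltW.
exists (M1 + G * Q0%:R + 2 * G + 1).
  by move: M10 GQ G0; olra.
move=> N t tmin i j k l x L y L' /andP[ij jN] /andP[kl lN] ML ML' xi jx ky yl.
have tnd := tmin.1.
have [m1 /andP[m1a m1b]] := points_floor qs x.
have [m2 /andP[m2a m2b]] := points_floor qs (x + L).
have [m3 /andP[m3a m3b]] := points_floor qs y.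
have [m4 /andP[m4a m4b]] := points_floor qs (y + L').
have g1 := GP m1; have g2 := GP m2; have g3 := GP m3; have g4 := GP m4.
(* The first window is rounded outwards to keep its points, the second inwards so that it is still
   crossed. *)
set A := s (m2 + 1) - s m1; set B := s m4 - s (m3 + 1).
have r1 : (rank s N t m1 <= i)%N.
  by rewrite leqNgt rank_gtP ?(leq_trans ij) // -leNgt; apply: le_trans xi.
have r2 : (j < rank s N t (m2 + 1))%N by rewrite rank_gtP //; apply: le_lt_trans m2b.
have r3 : (k < rank s N t (m3 + 1))%N.
  by rewrite rank_gtP ?(leq_trans kl) //; apply: le_lt_trans m3b.
have r4 : (rank s N t m4 <= l)%N.
  by rewrite leqNgt rank_gtP // -leNgt; apply: le_trans yl.
have far (m m' : int) : G * Q0%:R < s m' - s m -> m + Q0%:Z <= m'.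
  move=> h; rewrite leNgt; apply/negP => mm.
  have := points_gap_le GP m Q0; rewrite -(points_lt qs) in mm.
  by move: mm h; olra.
have LA : L <= A by rewrite /A; move: m1a m2b; olra.
have AL : A <= L + 2 * G by rewrite /A; move: m1b m2a g1 g2; olra.
have BL : B <= L' by rewrite /B; move: m3b m4a; olra.
have LB : L' <= B + 2 * G by rewrite /B; move: m3a m4b g3 g4; olra.
have d12 : m1 + Q0%:Z <= m2 + 1.
  by apply: far; rewrite -/A; move: LA ML M10 G0; olra.
have d34 : m3 + 1 + Q0%:Z <= m4.
  by apply: far; rewrite -/B; move: LB ML' M10 G0; olra.
have := Q0P N t tmin m1 (m2 + 1) (m3 + 1) m4 d12 d34 (leq_ltn_trans (leq0n _) r3)
  (leq_trans r4 lN).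
rewrite -/A -/B => key.
have L0 : 0 < L by move: ML M10 GQ G0; olra.
have L'0 : 0 < L' by move: ML' M10 GQ G0; olra.
have B0 : 0 < B by move: LB ML' M10 GQ G0; olra.
have A0 : 0 < A by move: LA L0; olra.
have AL1 : A <= (1 + e1) * L.
  have : M1 * e1 <= L * e1.
    by rewrite ler_pM2r //; move: ML GQ G0; olra.
  rewrite M1E; have : 0 <= G * e1 by rewrite mulr_ge0 // ltW.
  by move: AL; olra.
have LB1 : L' <= (1 + e1) * B.
  have : M1 * e1 <= B * e1.
    by rewrite ler_pM2r //; move: ML' LB GQ G0; olra.
  rewrite M1E; have : 0 <= G * e1 by rewrite mulr_ge0 // ltW.
  by move: LB; olra.
set X : R := (j - i)%:R; set Y : R := (l - k)%:R.
have X0 : 0 <= X by rewrite /X.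
have Y0 : 0 <= Y by rewrite /Y.
have key1 : X * B <= (1 + e1) * Y * A + e1 * (A * B).
  apply: (@le_trans _ _ ((rank s N t (m2 + 1) - rank s N t m1)%:R * B)).
    by rewrite ler_wpM2r ?ler_nat ?(ltW B0) //; move: r1 r2 ij; clear; lia.
  apply: (le_trans key); rewrite lerD2r ler_wpM2r ?(ltW A0) // ler_wpM2l //.
  by rewrite /Y ler_nat; move: r3 r4; clear; lia.
have s1 : X * L' <= (1 + e1) * (X * B).
  by rewrite mulrCA ler_wpM2l.
have s2 : (1 + e1) * (X * B) <= (1 + e1) * ((1 + e1) * Y * A + e1 * (A * B)).
  by rewrite ler_wpM2l.
have s3 : (1 + e1) * Y * A <= (1 + e1) * Y * ((1 + e1) * L).
  by rewrite ler_wpM2l // mulr_ge0.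
have s4 : A * B <= (1 + e1) * L * L' by rewrite ler_pM // ltW.
have s5 : (1 + e1) * ((1 + e1) * Y * A + e1 * (A * B)) <=
    (1 + e1) * ((1 + e1) * Y * ((1 + e1) * L) + e1 * ((1 + e1) * L * L')).
  by apply: (ler_wpM2l f0); apply: (lerD s3); apply: (ler_wpM2l (ltW e10)).
have c3 : (1 + e1) * (1 + e1) * (1 + e1) <= 1 + e.
  have : e1 * e1 <= 1 / 7 * e1.
    exact: (ler_wpM2r (ltW e10) e1l).
  have : e1 * e1 * e1 <= 1 / 7 * e1 * e1.
    exact: (ler_wpM2r (ltW e10) (ler_wpM2r (ltW e10) e1l)).
  by move: e1e e10; olra.
have c2 : (1 + e1) * e1 * (1 + e1) <= e.
  have : e1 * e1 <= 1 / 7 * e1.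
    exact: (ler_wpM2r (ltW e10) e1l).
  have : e1 * e1 * e1 <= 1 / 7 * e1 * e1.
    exact: (ler_wpM2r (ltW e10) (ler_wpM2r (ltW e10) e1l)).
  by move: e1e e10; olra.
apply: (le_trans s1); apply: (le_trans s2); apply: (le_trans s5).
rewrite mulrDr; apply: lerD.
  rewrite [leLHS](_ : _ = (1 + e1) * (1 + e1) * (1 + e1) * (Y * L)); last by ring.
  rewrite -[leRHS]mulrA; apply: ler_wpM2r c3; exact: (mulr_ge0 Y0 (ltW L0)).
rewrite [leLHS](_ : _ = (1 + e1) * e1 * (1 + e1) * (L * L')); last by ring.
by apply: ler_wpM2r c2; exact: (mulr_ge0 (ltW L0) (ltW L'0)).
Qed.

Lemma bounded_jumps : uniform_jump_bound H.
Proof.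
move=> L0; have [G G0 GP] := max_gap qs; have [g g0 gP] := min_gap qs.
have [kappa kP] := core_count_window qs hV dU ddU U2 dV.
pose p := (Num.bound (`|L0| / g)).+2.
have pP : L0 <= g * p.-2%:R.
  apply: le_trans (ler_norm _) _.
  by rewrite [leRHS]mulrC -ler_pdivrMr // ltW // archi_boundP // divr_ge0 // ltW.
have [Q0 Q0P] := kP p.
have [K1 K10 K1P] := block_recurrence qs (kappa + p + kappa).
pose Q := (Q0 + K1)%N.
exists (G * (Q + p + 2)%:R); first by rewrite mulr_gt0 // ltr0n addn2.
move=> N t tmin i iN iL k kN; rewrite leNgt; apply/negP => jump.
have tnd := tmin.1.
have [m1 /andP[m1a m1b]] := points_floor qs (t i).
have [m /andP[ma mb]] := points_floor qs (t k).
have r1 : (rank s N t m1 <= i)%N.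
  by rewrite leqNgt rank_gtP // -?leNgt //; lia.
have r2 : (i + 5 < rank s N t (m1 + p%:Z))%N.
  rewrite rank_gtP //; have := points_gap_ge gP (m1 + 1) p.-1.
  rewrite (_ : m1 + 1 + p.-1%:Z = m1 + p%:Z); last by lia.
  have : g * p.-2%:R <= g * p.-1%:R by rewrite ler_pM2l // ler_nat.
  by move: iL m1b pP; olra.
have r3 : (k < rank s N t (m + 1))%N by rewrite rank_gtP // ltnW.
have r4 : (rank s N t (m + 1 + Q%:Z + p%:Z) <= k.+1)%N.
  rewrite leqNgt rank_gtP // -leNgt.
  have := points_gap_le GP m (Q + p + 1).
  rewrite (_ : m + (Q + p + 1)%N%:Z = m + 1 + Q%:Z + p%:Z); last by lia.
  have : G * (Q + p + 1)%:R <= G * (Q + p + 2)%:R by rewrite ler_pM2l // ler_nat; lia.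
  by move: jump ma; olra.
(* A copy of the core that holds six points lies inside the long jump, where the count is 0; this
   exceeds the allowed difference of 4. *)
have [j jK e] := K1P (m1 - kappa%:Z) (m + 1 - kappa%:Z).
have := Q0P N t tmin (m + 1 - kappa%:Z) Q; rewrite subrK.
move=> /(_ ltac:(rewrite /Q; lia) (leq_ltn_trans (leq0n _) r3) (leq_trans r4 kN)).
move=> /(_ _ j ltac:(rewrite /Q; clear -jK; lia) e); rewrite subrK /core_count.
have : (k < rank s N t (m + 1 + j%:Z))%N.
  by apply: (leq_trans r3); apply: (rank_homo qs tnd); clear; lia.
have : (rank s N t (m + 1 + j%:Z + p%:Z) <= k.+1)%N.
  by apply: leq_trans r4; apply: (rank_homo qs tnd); rewrite /Q; clear -jK; lia.
by move: r1 r2; clear; lia.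
Qed.

End WindowDensity.

(** * Density of minimal configurations *)

Section ConfigurationDensity.
Context {R : realType}.
Variable H : R -> R -> R.
Implicit Types (theta : int -> R).

Hypothesis window : uniform_density H.

Hypothesis jumps : uniform_jump_bound H.

Lemma configuration_window (e : R) : 0 < e -> exists2 M : R, 0 < M &
  forall theta, minimal_configuration H theta ->
  forall (i j k l : int) (x L y L' : R), i <= j -> k <= l ->
    M <= L -> M <= L' -> x <= theta i -> theta j <= x + L ->
    theta k <= y -> y + L' <= theta l ->
  (j - i)%:~R * L' <= (1 + e) * (l - k)%:~R * L + e * (L * L').
Proof.
move=> e0; have [M M0 MP] := window e0; exists M => // theta [_ tmin].
move=> i j k l x L y L' ij kl ML ML' xi jx ky yl.
pose b := Num.min i k; pose N := `|Num.max j l - b|.+1.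
have bi : b <= i by rewrite ge_min lexx.
have bk : b <= k by rewrite ge_min lexx orbT.
have jN : j <= Num.max j l by rewrite le_max lexx.
have lN : l <= Num.max j l by rewrite le_max lexx orbT.
have bE (q : int) : b <= q -> b + `|q - b|%N%:Z = q by lia.
have := MP N _ (tmin b N isT) `|i - b|%N `|j - b|%N `|k - b|%N `|l - b|%N x L y L'.
rewrite !bE //; try lia.
rewrite (_ : (`|j - b| - `|i - b|)%N%:R = (j - i)%:~R); last first.
  by rewrite pmulrn; congr (_%:~R); lia.
rewrite (_ : (`|l - b| - `|k - b|)%N%:R = (l - k)%:~R); last first.
  by rewrite pmulrn; congr (_%:~R); lia.
apply => //; rewrite /N; lia.
Qed.

Lemma configuration_jumps (L0 : R) : exists2 K : R, 0 < K &
  forall theta, minimal_configuration H theta ->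
  forall i, theta (i + 5) - theta i <= L0 ->
  forall k, theta (k + 1) - theta k <= K.
Proof.
have [K K0 KP] := jumps L0; exists K => // theta [_ tmin] i iL k.
pose b := Num.min i k; pose N := (`|Num.max i k - b| + 6)%N.
have bi : b <= i by rewrite ge_min lexx.
have bk : b <= k by rewrite ge_min lexx orbT.
have jN : i <= Num.max i k by rewrite le_max lexx.
have lN : k <= Num.max i k by rewrite le_max lexx orbT.
have N1 : (1 <= N)%N by rewrite /N; lia.
have := KP N _ (tmin b N N1) `|i - b|%N.
rewrite (_ : b + (`|i - b| + 5)%N%:Z = i + 5); last lia.
rewrite (_ : b + `|i - b|%N%:Z = i); last lia.
move=> /(_ ltac:(rewrite /N; lia) iL `|k - b|%N ltac:(rewrite /N; lia)).
rewrite (_ : b + `|k - b|.+1%N%:Z = k + 1); last lia.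
by rewrite (_ : b + `|k - b|%N%:Z = k); last lia.
Qed.

Definition unbounded theta := forall B, (exists n, B <= theta n) /\ (exists n, theta n <= B).

Definition has_density theta (b : R) := 0 < b /\
  forall e, 0 < e -> exists M, forall i j, i <= j -> M <= theta j - theta i ->
    `|(j - i)%:~R - b * (theta j - theta i)| <= e * (theta j - theta i).

Lemma wide_unbounded : exists2 M1 : R, 0 < M1 &
  forall theta, minimal_configuration H theta ->
  forall k l, k <= l -> M1 <= theta l - theta k -> unbounded theta.
Proof.
have [M M0 MP] := configuration_window ltr01; exists M => // theta tmin k l kl wide B.
have [tmono _] := tmin.
set L' := theta l - theta k in wide.
have L'0 : 0 < L' by exact: lt_le_trans wide.
split; apply: contrapT => nB.
- have tB n : theta n < B by rewrite ltNge; apply/negP => h; apply: nB; exists n.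
  pose L := Num.max M (B - theta k).
  have ML : M <= L by rewrite le_max lexx.
  have LB : B - theta k <= L by rewrite le_max lexx orbT.
  pose n := Num.bound (2 * (l - k)%:~R * L / L' + L).
  have := @MP theta tmin k (k + n%:Z) k l (theta k) L (theta k) L' ltac:(lia) kl ML wide
    (lexx _).
  move=> /(_ ltac:(have := tB (k + n%:Z); lra) (lexx _) ltac:(rewrite /L'; lra)).
  rewrite (_ : (k + n%:Z - k) = n%:Z); last lia.
  rewrite mul1r (_ : 1 + 1 = 2 :> R) // -pmulrn => h.
  have : (n%:R : R) <= 2 * (l - k)%:~R * L / L' + L.
    by rewrite -(ler_pM2r L'0) mulrDl divfK ?gt_eqF.
  apply/negP; rewrite -ltNge archi_boundP // addr_ge0 ?divr_ge0 ?mulr_ge0 //.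
  + by rewrite ler0z; lia.
  + exact: le_trans (ltW M0) ML.
  + exact: ltW.
  + exact: le_trans (ltW M0) ML.
- have tB n : B < theta n by rewrite ltNge; apply/negP => h; apply: nB; exists n.
  pose L := Num.max M (theta k - B).
  have ML : M <= L by rewrite le_max lexx.
  have LB : theta k - B <= L by rewrite le_max lexx orbT.
  pose n := Num.bound (2 * (l - k)%:~R * L / L' + L).
  have := @MP theta tmin (k - n%:Z) k k l (theta k - L) L (theta k) L' ltac:(lia) kl ML wide.
  move=> /(_ ltac:(have := tB (k - n%:Z); lra) ltac:(lra) (lexx _) ltac:(rewrite /L'; lra)).
  rewrite (_ : (k - (k - n%:Z)) = n%:Z); last lia.
  rewrite mul1r (_ : 1 + 1 = 2 :> R) // -pmulrn => h.
  have : (n%:R : R) <= 2 * (l - k)%:~R * L / L' + L.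
    by rewrite -(ler_pM2r L'0) mulrDl divfK ?gt_eqF.
  apply/negP; rewrite -ltNge archi_boundP // addr_ge0 ?divr_ge0 ?mulr_ge0 //.
  + by rewrite ler0z; lia.
  + exact: le_trans (ltW M0) ML.
  + exact: ltW.
  + exact: le_trans (ltW M0) ML.
Qed.

Lemma unbounded_window theta (B : R) : configuration theta -> unbounded theta ->
  exists k l, k <= l /\ B <= theta l - theta k.
Proof.
move=> tmono tu; have [[n nB] _] := tu (theta 0 + `|B|).
have Bn := ler_norm B; have B0 := normr_ge0 B.
have [n0|n0] := leP 0 n; first by exists 0, n; split => //; lra.
by exists 0, 0; split => //; have := tmono _ _ (ltW n0); lra.
Qed.

(** The window estimate makes the mean densities [beta] a Cauchy family as the length grows; the
    jump bound keeps the limit positive. *)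
Lemma density_exists theta : minimal_configuration H theta -> unbounded theta ->
  exists b, has_density theta b.
Proof.
move=> tmin tu; have [tmono _] := tmin.
have [M1 M10 M1P] := configuration_window ltr01.
have [k0 [l0 [kl0 wide0]]] := unbounded_window M1 tmono tu.
pose beta (i j : int) : R := (j - i)%:~R / (theta j - theta i).
pose D0 := 2 * beta k0 l0 + 1.
have key e M : (forall (i j k l : int) (x L y L' : R), i <= j -> k <= l ->
    M <= L -> M <= L' -> x <= theta i -> theta j <= x + L ->
    theta k <= y -> y + L' <= theta l ->
    (j - i)%:~R * L' <= (1 + e) * (l - k)%:~R * L + e * (L * L')) -> 0 < M ->
    forall i j k l, i <= j -> k <= l -> M <= theta j - theta i -> M <= theta l - theta k ->
    beta i j <= (1 + e) * beta k l + e.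
  move=> h M0 i j k l ij kl Mij Mkl.
  have L0 := lt_le_trans M0 Mij; have L'0 := lt_le_trans M0 Mkl.
  have := h i j k l (theta i) (theta j - theta i) (theta k) (theta l - theta k) ij kl Mij Mkl
    (lexx _) ltac:(lra) (lexx _) ltac:(lra).
  rewrite /beta; set L := theta j - theta i in L0 *; set L' := theta l - theta k in L'0 *.
  move=> h1; rewrite ler_pdivrMr // -(ler_pM2r L'0).
  apply: (le_trans h1); rewrite [leRHS](_ : _ =
    (1 + e) * (l - k)%:~R * L * (L' / L') + e * (L * L')); last by ring.
  by rewrite divff ?gt_eqF // mulr1.
have betaD i j : i <= j -> M1 <= theta j - theta i -> beta i j <= D0.
  by move=> ij w; have := key _ _ (M1P theta tmin) M10 i j k0 l0 ij kl0 w wide0.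
have beta0 i j : i <= j -> 0 <= beta i j.
  by move=> ij; rewrite divr_ge0 ?ler0z ?subr_ge0 // tmono.
have D00 : 0 <= D0 by rewrite addr_ge0 // mulr_ge0 // beta0.
have close e : 0 < e -> exists2 M, 0 < M & forall i j k l, i <= j -> k <= l ->
    M <= theta j - theta i -> M <= theta l - theta k -> beta i j <= beta k l + e.
  (* The bound [D0] on the densities turns the relative error into an absolute one. *)
  move=> e0; pose e1 := e / (D0 + 1).
  have D1 : 0 < D0 + 1 by rewrite ltr_wpDl.
  have e10 : 0 < e1 by rewrite divr_gt0.
  have [M M0 MP] := configuration_window e10.
  exists (Num.max M M1); first by rewrite lt_max M0.
  move=> i j k l ij kl; rewrite !ge_max => /andP[w1 w2] /andP[w3 w4].
  have h1 := key _ _ (MP theta tmin) M0 i j k l ij kl w1 w3.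
  have h2 := betaD k l kl w4.
  apply: (le_trans h1); rewrite mulrDl mul1r -addrA lerD2l.
  rewrite -[e1 in X in _ + X]mulr1 -mulrDr.
  apply: (@le_trans _ _ (e1 * (D0 + 1))); first by rewrite ler_pM2l // lerD2r.
  by rewrite /e1 divfK // gt_eqF.
(* Any six consecutive points will do, since [K] may depend on [theta] here. *)
have [K K0 KP] := configuration_jumps (theta (0 + 5) - theta 0).
have jump k := KP theta tmin 0 (lexx _) k.
have betaK i j : i <= j -> 0 < theta j - theta i -> K^-1 <= beta i j.
  move=> ij w; rewrite /beta ler_pdivlMr // mulrC ler_pdivrMr //.
  have : theta (i + `|j - i|%N%:Z) - theta i <= `|j - i|%N%:R * K.
    elim: `|j - i|%N => [|n IH]; first by rewrite addr0 subrr mul0r.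
    have := jump (i + n%:Z); rewrite -addrA (_ : (n%:Z + 1) = n.+1%:Z); last lia.
    by rewrite -[n.+1%:R]natr1 mulrDl mul1r; lra.
  rewrite (_ : i + _ = j); last lia.
  by rewrite pmulrn (_ : `|j - i|%N%:Z = j - i) //; lia.
(* [S] consists of the eventual lower bounds of [beta], so its supremum is the lower limit. *)
pose S : set R := [set r | exists2 M, 0 < M &
  forall i j, i <= j -> M <= theta j - theta i -> r <= beta i j].
have SK : S K^-1.
  by exists 1 => // i j ij w; apply: betaK => //; apply: lt_le_trans w.
have SD : ubound S D0.
  move=> r [M M0 MP]; have [k [l [kl w]]] := unbounded_window (Num.max M M1) tmono tu.
  move: w; rewrite ge_max => /andP[w1 w2].
  exact: le_trans (MP _ _ kl w1) (betaD _ _ kl w2).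
have Ssup : has_sup S by split; [exists K^-1|exists D0].
exists (sup S); split.
  by apply: (@lt_le_trans _ _ K^-1); [rewrite invr_gt0|apply: sup_upper_bound].
move=> e e0; have [M M0 MP] := close e e0; exists M => i j ij w.
have L0 := lt_le_trans M0 w.
have -> : (j - i)%:~R = beta i j * (theta j - theta i) by rewrite /beta divfK // gt_eqF.
rewrite -mulrBl normrM (gtr0_norm L0) ler_pM2r //; apply/ler_normlP; split.
- rewrite opprB lerBlDr; apply: ge_sup; first by exists K^-1.
  move=> r [M' M'0 M'P]; have [k [l [kl]]] := unbounded_window (Num.max M M') tmono tu.
  rewrite ge_max => /andP[w1 w2]; apply: (le_trans (M'P _ _ kl w2)).
  by rewrite addrC; apply: MP.
- rewrite lerBlDr addrC -lerBlDr; apply: sup_upper_bound => //.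
  by exists M => // k l kl w'; rewrite lerBlDr; apply: MP.
Qed.

End ConfigurationDensity.

(** * Rotation number *)

Section Rotation.
Context {R : realType}.
Implicit Types (theta : int -> R).

Lemma ptws_eval_continuous (I : choiceType) (i : I) :
  continuous (fun g : {ptws I -> R} => g i).
Proof. exact: (@proj_continuous I (fun=> R) i). Qed.

Lemma ptws_eval_near (I : choiceType) (f : {ptws I -> R}) (i : I) (e : R) : 0 < e ->
  nbhs f [set g : {ptws I -> R} | `|g i - f i| < e].
Proof.
move=> e0; have h := @ptws_eval_continuous I i f _ (nbhsx_ballx (f i) e e0).
rewrite (_ : mkset _ = (fun g : {ptws I -> R} => g i) @^-1` ball (f i) e); first exact: h.
by apply/seteqP; split => g; rewrite /ball /= distrC.
Qed.

Lemma ratio_cvg (L : nat -> R) (c b : R) : 0 < b ->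
  (forall e, 0 < e -> exists n0, forall n, (n0 <= n)%N ->
     `|n%:R - b * L n| <= e * L n) ->
  (L n + c) / n%:R @[n --> \oo] --> b^-1.
Proof.
move=> b0 h; apply/cvgrPdist_le => eps eps0.
(* The first bound gives [L n <= 2 / b * n]; the second then makes the deviation at most [eps / 2].
   The offset [c] takes the other half. *)
pose e := Num.min (b / 2) (eps * b ^+ 2 / 4).
have e0 : 0 < e by rewrite lt_min !divr_gt0 // mulr_gt0 // exprn_gt0.
have e1 : e <= b / 2 by rewrite ge_min lexx.
have e2 : e <= eps * b ^+ 2 / 4 by rewrite ge_min lexx orbT.
have [n0 hn] := h e e0.
exists (n0 + Num.bound (2 * `|c| / eps) + 1)%N => // n /= nn.
have n1 : 0 < n%:R :> R by rewrite ltr0n; lia.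
have cn : `|c| / n%:R <= eps / 2.
  have : 2 * `|c| / eps <= n%:R.
    apply: ltW; apply: (@lt_le_trans _ _ (Num.bound (2 * `|c| / eps))%:R).
      by rewrite archi_boundP // divr_ge0 ?mulr_ge0 // ltW.
    by rewrite ler_nat; lia.
  rewrite !ler_pdivrMr //; lra.
have hL := hn n ltac:(lia).
have L0 : 0 <= L n by rewrite -(pmulr_rge0 _ e0); apply: le_trans hL.
have L2 : L n <= 2 / b * n%:R.
  have : e * L n <= b / 2 * L n by rewrite ler_wpM2r.
  move: hL => /ler_normlP[h1 h2] h3.
  rewrite mulrAC ler_pdivlMr //; lra.
have E : b^-1 - (L n + c) / n%:R = - (n%:R - b * L n) * (-1) / (b * n%:R) - c / n%:R.
  by field; rewrite !gt_eqF.
rewrite E; apply: (le_trans (ler_normB _ _)).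
have -> : `|c / n%:R| = `|c| / n%:R by rewrite normrM normfV (gtr0_norm n1).
have bn : 0 < b * n%:R by rewrite mulr_gt0.
suff : `| - (n%:R - b * L n) * (-1) / (b * n%:R)| <= eps / 2 by lra.
rewrite mulrN1 opprK normrM normfV (gtr0_norm bn) ler_pdivrMr //.
apply: (le_trans hL); apply: (@le_trans _ _ (e * (2 / b * n%:R))).
  by rewrite ler_pM2l.
apply: (@le_trans _ _ (eps * b ^+ 2 / 4 * (2 / b * n%:R))).
  by rewrite ler_wpM2r // mulr_ge0 // divr_ge0 // ltW.
by rewrite le_eqVlt; apply/orP; left; apply/eqP; field; rewrite gt_eqF.
Qed.

Lemma density_rotation theta b : configuration theta -> unbounded theta ->
  has_density theta b -> has_rotation_number theta b^-1.
Proof.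
move=> tmono tu [b0 hb]; split.
- rewrite (_ : (fun n : nat => theta n%:Z / n%:R) =
     (fun n : nat => (theta n%:Z - theta 0 + theta 0) / n%:R)); last first.
    by apply/funext => n; rewrite subrK.
  apply: ratio_cvg => // e e0; have [M MP] := hb e e0.
  have [[m mM] _] := tu (theta 0 + M).
  exists `|m|%N => n mn; have := MP 0 n%:Z isT; rewrite subr0; apply.
  have := tmono m n%:Z ltac:(lia); lra.
- rewrite (_ : (fun n : nat => theta (- n%:Z) / - n%:R) =
     (fun n : nat => (theta 0 - theta (- n%:Z) + (- theta 0)) / n%:R)); last first.
    by apply/funext => n; rewrite addrAC subrr sub0r invrN mulrN mulNr.
  apply: ratio_cvg => // e e0; have [M MP] := hb e e0.
  have [_ [m mM]] := tu (theta 0 - M).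
  exists `|m|%N => n mn; have := MP (- n%:Z) 0 ltac:(lia); rewrite sub0r opprK; apply.
  have := tmono (- n%:Z) m ltac:(lia); lra.
Qed.

Lemma bounded_rotation theta (B : R) : (forall n, `|theta n| <= B) ->
  has_rotation_number theta 0.
Proof.
move=> tB.
have B0 : 0 <= B by apply: le_trans (tB 0).
have main (f : nat -> R) : (forall n, `|f n| <= B) -> f n / n%:R @[n --> \oo] --> (0 : R).
  move=> fB; apply/cvgrPdist_le => e e0.
  exists (Num.bound (B / e)).+1 => // n /= nn.
  have n0 : 0 < n%:R :> R by rewrite ltr0n; lia.
  rewrite sub0r normrN normrM normfV (gtr0_norm n0) ler_pdivrMr //.
  apply: (le_trans (fB n)); rewrite mulrC -ler_pdivrMr //.
  apply: ltW; apply: (@lt_le_trans _ _ (Num.bound (B / e))%:R).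
    by rewrite archi_boundP // divr_ge0 // ltW.
  by rewrite ler_nat; lia.
split; first exact: main.
rewrite (_ : (fun n : nat => theta (- n%:Z) / - n%:R) =
     (fun n : nat => (- theta (- n%:Z)) / n%:R)); last first.
  by apply/funext => n; rewrite invrN mulrN mulNr.
by apply: main => n; rewrite normrN.
Qed.

Lemma rotation_numberE theta rho : has_rotation_number theta rho ->
  rotation_number theta = rho.
Proof.
move=> h; have h' : has_rotation_number theta (rotation_number theta).
  by apply: (@getPex _ [set r | has_rotation_number theta r]); exists rho.
exact: (cvg_unique _ h'.1 h.1).
Qed.

End Rotation.

Section RotationNumber.
Context {R : realType}.
Variable H : R -> R -> R.
Implicit Types (theta : int -> R).

Hypothesis window : uniform_density H.

Hypothesis jumps : uniform_jump_bound H.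

(** The width bound [M1] in the bounded case is common to all configurations; continuity at rotation
    number 0 uses this. *)
Lemma minimal_rotation : exists2 M1 : R, 0 < M1 &
  forall theta, minimal_configuration H theta ->
    (unbounded theta /\ exists2 b, has_density theta b & has_rotation_number theta b^-1) \/
    ((forall k l, k <= l -> theta l - theta k < M1) /\ has_rotation_number theta 0).
Proof.
have [M1 M10 M1P] := wide_unbounded window; exists M1 => // theta tmin.
have [[k [l [kl w]]]|nw] := pselect (exists k l, k <= l /\ M1 <= theta l - theta k).
  have tu := M1P theta tmin k l kl w; left; split => //.
  have [b hb] := density_exists window jumps tmin tu.
  by exists b => //; apply: density_rotation => //; case: tmin.
have {}nw k l : k <= l -> theta l - theta k < M1.
  by move=> kl; rewrite ltNge; apply/negP => w; apply: nw; exists k, l.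
right; split => //.
apply: (@bounded_rotation _ _ (`|theta 0| + M1)) => n.
have [tmono _] := tmin.
have := ler_norm (theta 0); have := ler_norm (- theta 0); rewrite normrN => h1 h2.
have [n0|n0] := leP 0 n; apply/ler_normlP.
  by have := nw _ _ n0; have := tmono _ _ n0; split; lra.
by have := nw _ _ (ltW n0); have := tmono _ _ (ltW n0); split; lra.
Qed.

(** A finite window is compared with windows of the same configuration whose length tends to
    infinity and whose density tends to [b]. *)
Lemma density_window (e : R) : 0 < e -> exists2 M : R, 0 < M &
  forall theta b, minimal_configuration H theta -> unbounded theta -> has_density theta b ->
  (forall i j x L, i <= j -> M <= L -> x <= theta i -> theta j <= x + L ->
     (j - i)%:~R <= ((1 + e) * b + e) * L) /\
  (forall k l, k <= l -> M <= theta l - theta k ->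
     b * (theta l - theta k) <= (1 + e) * (l - k)%:~R + e * (theta l - theta k)).
Proof.
move=> e0; have [M M0 MP] := configuration_window window e0; exists M => //.
move=> theta b tmin tu [b0 hb]; have [tmono _] := tmin.
have e1 : 0 < 1 + e by rewrite addr_gt0.
split=> [i j x L ij ML xi jx|k l kl ML].
- have L0 := lt_le_trans M0 ML.
  apply/ler_addgt0Pr => d d0.
  pose d1 := d / ((1 + e) * L).
  have d10 : 0 < d1 by rewrite divr_gt0 // mulr_gt0.
  have [M' M'P] := hb d1 d10.
  have [k [l [kl]]] := unbounded_window (Num.max M M') tmono tu.
  rewrite ge_max => /andP[w1 w2].
  have := MP theta tmin i j k l x L (theta k) (theta l - theta k) ij kl ML w1 xi jx (lexx _).
  move=> /(_ ltac:(lra)); have := M'P k l kl w2.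
  have L'0 : 0 < theta l - theta k := lt_le_trans M0 w1.
  set L' := theta l - theta k in L'0 * => /ler_normlP[_ h1] h2.
  rewrite -(ler_pM2r L'0); apply: (le_trans h2).
  have h3 : (1 + e) * (l - k)%:~R * L <= (1 + e) * (b * L' + d1 * L') * L.
    by rewrite ler_pM2r // ler_pM2l //; lra.
  have h4 : (1 + e) * (d1 * L') * L = d * L'.
    by rewrite /d1; field; rewrite !gt_eqF.
  by move: h3; rewrite mulrDr mulrDl h4; lra.
- set L := theta l - theta k in ML *.
  have L0 := lt_le_trans M0 ML.
  apply/ler_addgt0Pr => d d0.
  pose d1 := d / L.
  have d10 : 0 < d1 by rewrite divr_gt0.
  have [M' M'P] := hb d1 d10.
  have [i [j [ij]]] := unbounded_window (Num.max M M') tmono tu.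
  rewrite ge_max => /andP[w1 w2].
  have := MP theta tmin i j k l (theta i) (theta j - theta i) (theta k) L ij kl w1 ML (lexx _).
  move=> /(_ ltac:(lra) (lexx _) ltac:(rewrite /L; lra)); have := M'P i j ij w2.
  have L'0 : 0 < theta j - theta i := lt_le_trans M0 w1.
  set L' := theta j - theta i in L'0 * => /ler_normlP[h1 _] h2.
  rewrite -(ler_pM2r L'0).
  have h3 : (b * L' - d1 * L') * L <= (j - i)%:~R * L.
    by rewrite ler_pM2r //; lra.
  have h4 : d1 * L' * L = d * L' by rewrite /d1; field; rewrite gt_eqF.
  move: h3; rewrite mulrBl h4; lra.
Qed.

End RotationNumber.

(** * Continuity of the rotation number *)

Section RotationContinuity.
Context {R : realType}.
Variable H : R -> R -> R.
Implicit Types (theta : int -> R).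

Hypothesis window : uniform_density H.

Hypothesis jumps : uniform_jump_bound H.

Lemma inv_close (b b' e : R) : 0 < b -> 0 < e ->
  `|b' - b| <= b / 2 -> `|b' - b| <= e * b ^+ 2 / 4 -> `|b^-1 - b'^-1| < e.
Proof.
move=> b0 e0 h1 h2; have b'0 : b / 2 <= b' by move/ler_normlP: h1 => [? ?]; lra.
have b'1 : 0 < b' by apply: lt_le_trans b'0; rewrite divr_gt0.
have -> : b^-1 - b'^-1 = (b' - b) / (b * b') by field; rewrite !gt_eqF.
have bb : 0 < b * b' by rewrite mulr_gt0.
rewrite normrM normfV (gtr0_norm bb) ltr_pdivrMr //.
apply: (le_lt_trans h2); apply: (@lt_le_trans _ _ (e * (b * (b / 2)))).
  have : 0 < e * b ^+ 2 by rewrite mulr_gt0 // exprn_gt0.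
  by rewrite expr2; lra.
by rewrite ler_pM2l // ler_pM2l.
Qed.

(** Two coordinates fix the number of steps and, nearly, the length of one long window, and the
    density of one window determines the asymptotic density up to a uniform error. *)
Lemma density_close (b : R) (d : R) : 0 < b -> 0 < d ->
  forall theta, minimal_configuration H theta -> unbounded theta -> has_density theta b ->
  exists k l (eta : R), [/\ k <= l, 0 < eta &
    forall theta', minimal_configuration H theta' ->
    `|theta' k - theta k| < eta -> `|theta' l - theta l| < eta ->
    unbounded theta' /\ forall b', has_density theta' b' -> `|b' - b| <= d].
Proof.
move=> b0 d0 theta tmin tu tb.
have [tmono _] := tmin.
pose e1 := Num.min 1 (d / (5 * b + 8)).
have c0 : 0 < 5 * b + 8 by rewrite addr_gt0 // mulr_gt0.
have e10 : 0 < e1 by rewrite lt_min ltr01 divr_gt0.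
have e11 : e1 <= 1 by rewrite ge_min lexx.
have e1d : e1 * (5 * b + 8) <= d by rewrite -ler_pdivlMr // ge_min lexx orbT.
have [M1 M10 M1P] := wide_unbounded window.
have [M M0 MP] := density_window window e10.
have [M' M'P] := tb.2 e1 e10.
have [k [l [kl]]] := unbounded_window (Num.max (Num.max (M1 + 2) (M + 2)) M') tmono tu.
rewrite !ge_max => /andP[/andP[w1 w2] w3].
(* The length of the window then changes by at most [e1 <= 1], so the perturbed window stays beyond
   the thresholds [M1] and [M]. *)
exists k, l, (e1 / 2); split => //; first by rewrite divr_gt0.
move=> theta' tmin' hk hl.
set L := theta l - theta k in w1 w2 w3.
pose L' := theta' l - theta' k.
have [LL1 LL2] : L' <= L + e1 /\ L <= L' + e1.
  by move: hk hl => /ltr_normlP[? ?] /ltr_normlP[? ?]; rewrite /L /L'; split; lra.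
have tu' : unbounded theta' by apply: (M1P theta' tmin' k l kl); rewrite -/L'; lra.
split => // b' tb'.
have [b'0 _] := tb'.
have [P1 P2] := MP theta' b' tmin' tu' tb'.
have := M'P k l kl w3; rewrite -/L => /ler_normlP[q1 q2].
have L'1 : 1 <= L' by lra.
have p1 := P1 k l (theta' k) L' kl ltac:(lra) (lexx _) ltac:(rewrite /L'; lra).
have p2 := P2 k l kl ltac:(rewrite -/L'; lra); rewrite -/L' in p2.
set n : R := (l - k)%:~R in q1 q2 p1 p2.
have L'0 : 0 < L' by lra.
have eL : e1 <= e1 * L' by rewrite ler_pMr.
have n1 : n <= (b + e1) * (1 + e1) * L'.
  have : (b + e1) * L <= (b + e1) * (L' + e1 * L').
    by rewrite ler_pM2l; [lra|rewrite addr_gt0].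
  by lra.
have n2 : b * (1 - e1) * L' - e1 * (1 + e1) * L' <= n.
  have : b * (L' - e1 * L') <= b * L by rewrite ler_pM2l //; lra.
  have : e1 * L <= e1 * (L' + e1 * L') by rewrite ler_pM2l //; lra.
  by lra.
have ee : e1 * e1 <= e1 by rewrite ler_piMr // ltW.
have ee0 : 0 <= e1 * e1 by rewrite mulr_ge0 // ltW.
have eee : e1 * e1 * e1 <= e1 by rewrite -mulrA; apply: (le_trans _ ee); rewrite ler_pM2l.
have be : b * (e1 * e1) <= b * e1 by rewrite ler_pM2l.
have U1 : b' <= b + e1 * (3 * b + 5).
  rewrite -(ler_pM2r L'0); apply: (le_trans p2).
  have : (1 + e1) * n <= (1 + e1) * ((b + e1) * (1 + e1) * L').
    by rewrite ler_pM2l // addr_gt0.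
  have : (b + e1) * (1 + e1) * (1 + e1) + e1 <= b + e1 * (3 * b + 5) by lra.
  by move=> h; have := ler_wpM2r (ltW L'0) h; lra.
have U2 : b - e1 * (5 * b + 8) <= b'.
  have h : b * (1 - e1) - e1 * (1 + e1) <= (1 + e1) * b' + e1.
    by rewrite -(ler_pM2r L'0); move: p1 n2; lra.
  have : e1 * b' <= e1 * (b + e1 * (3 * b + 5)) by rewrite ler_pM2l.
  by lra.
apply/ler_normlP; split; first lra.
have : e1 * (3 * b + 5) <= e1 * (5 * b + 8) by rewrite ler_pM2l //; lra.
lra.
Qed.

Lemma rotation_number_continuous :
  {within [set theta : {ptws int -> R} | minimal_configuration H theta],
    continuous (@rotation_number R)}.
Proof.
have [M1 M10 M1P] := minimal_rotation window jumps.
apply/subspace_continuousP => theta /= tmin; apply/cvgrPdist_lt => e e0.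
suff [k [l [eta [eta0 h]]]] : exists k l (eta : R), 0 < eta /\
    forall theta', minimal_configuration H theta' ->
    `|theta' k - theta k| < eta -> `|theta' l - theta l| < eta ->
    `|rotation_number theta - rotation_number theta'| < e.
  apply: filterS (filterI (ptws_eval_near theta k eta0) (ptws_eval_near theta l eta0)).
  by move=> theta' [hk hl] tmin'; apply: h.
have [[tu [b tb tr]]|[tw tr]] := M1P theta tmin.
  have [b0 _] := tb.
  pose d := Num.min (b / 2) (e * b ^+ 2 / 4).
  have d0 : 0 < d by rewrite lt_min !divr_gt0 // mulr_gt0 // exprn_gt0.
  have [k [l [eta [kl eta0 h]]]] := density_close b0 d0 tmin tu tb.
  exists k, l, eta; split => // theta' tmin' hk hl.
  have [tu' hb'] := h theta' tmin' hk hl.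
  have [[_ [b' tb' tr']]|[tw' _]] := M1P theta' tmin'; last first.
    have [k' [l' [kl']]] := unbounded_window M1 tmin'.1 tu'.
    by rewrite leNgt tw'.
  rewrite (rotation_numberE tr) (rotation_numberE tr').
  have := hb' b' tb'; rewrite le_min => /andP[h1 h2].
  exact: inv_close.
(* At a bounded configuration, a neighbour makes [2 * n] steps within length [L]. If it is
   unbounded, its density then exceeds [e^-1] and its rotation number is below [e]. *)
have [M M0 MP] := density_window window ltr01.
pose L := Num.max (M1 + 1) M.
have LM : M <= L by rewrite le_max lexx orbT.
have LM1 : M1 + 1 <= L by rewrite le_max lexx.
have L0 : 0 < L by apply: lt_le_trans LM.
pose n := (Num.bound (L / e + L)).+1.
have nP : L / e + L < n%:R.
  apply: (@lt_le_trans _ _ (Num.bound (L / e + L))%:R); last by rewrite ler_nat.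
  by rewrite archi_boundP // addr_ge0 ?divr_ge0 // ltW.
exists (- n%:Z), n%:Z, (2^-1); split; first by rewrite invr_gt0.
move=> theta' tmin' hk hl; rewrite (rotation_numberE tr) sub0r normrN.
have [[tu' [b' tb' tr']]|[_ tr']] := M1P theta' tmin'; last first.
  by rewrite (rotation_numberE tr') normr0.
rewrite (rotation_numberE tr').
have [b'0 _] := tb'.
rewrite gtr0_norm ?invr_gt0 // invf_plt ?posrE //.
have [P1 _] := MP theta' b' tmin' tu' tb'.
have wn := tw (- n%:Z) n%:Z ltac:(lia).
have := P1 (- n%:Z) n%:Z (theta' (- n%:Z)) L ltac:(lia) LM (lexx _).
have -> : (n%:Z - - n%:Z)%:~R = 2 * n%:R :> R.
  by rewrite (_ : n%:Z - - n%:Z = (2 * n)%N%:Z); [rewrite -pmulrn natrM|lia].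
move=> h; have {}h := h ltac:(move: hk hl => /ltr_normlP[? ?] /ltr_normlP[? ?]; lra).
have h2 : L / e < b' * L by lra.
by rewrite -(ltr_pM2r L0) (mulrC e^-1).
Qed.

End RotationContinuity.

(** * Existence of minimal segments and limits *)

Lemma max_continuous (R : realType) (T : topologicalType) (f g : T -> R) :
  continuous f -> continuous g -> continuous (fun x => Num.max (f x) (g x)).
Proof. by move=> cf cg x; apply: (@continuous_max R T f g x); [exact: cf|exact: cg]. Qed.

Lemma min_continuous (R : realType) (T : topologicalType) (f g : T -> R) :
  continuous f -> continuous g -> continuous (fun x => Num.min (f x) (g x)).
Proof. by move=> cf cg x; apply: (@continuous_min R T f g x); [exact: cf|exact: cg]. Qed.

Lemma sub_continuous (R : realType) (T : topologicalType) (f g : T -> R) :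
  continuous f -> continuous g -> continuous (fun x => f x - g x).
Proof. by move=> cf cg x; apply: cvgB; [exact: cf|exact: cg]. Qed.

Section MinimalExistence.
Context {R : realType}.
Variables U V : R -> R.
Hypothesis cU : continuous U.
Hypothesis cV : continuous V.

Local Notation H := (FK_energy U V).

Lemma continuous_segment_energy (T : topologicalType) (G : nat -> T -> R) (p : nat) :
  (forall j, continuous (G j)) ->
  continuous (fun f => segment_energy H p (fun j => G j f)).
Proof.
move=> cG; rewrite /segment_energy; elim: p => [|p IH].
  rewrite (_ : (fun f : T => _) = cst 0); first exact: cst_continuous.
  by apply/funext => f; rewrite big_geq.
rewrite (_ : (fun f : T => _) = (fun f =>
  \sum_(0 <= j < p) H (G j f) (G j.+1 f) + H (G p f) (G p.+1 f))); last first.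
  by apply/funext => f; rewrite big_nat_recr.
move=> f; apply: cvgD; first exact: IH.
apply: cvgD.
  apply: (@continuous_comp _ _ _ (fun f => G p f - G p.+1 f) U); last exact: cU.
  by apply: cvgB; exact: cG.
by apply: (@continuous_comp _ _ _ (G p) V); [exact: cG|exact: cV].
Qed.

(** A continuous parametrization of the nondecreasing sequences starting at [u], which fixes those
    sequences. Minimization can then be carried out on a full product of intervals. *)
Fixpoint running_max (u : R) (f : nat -> R) (j : nat) : R :=
  if j is j'.+1 then Num.max (running_max u f j') (f j) else u.

Lemma minimal_segment_exists (N : nat) (u v : R) : u <= v ->
  exists t, [/\ minimal_segment H N.+1 t, t 0%N = u & t N.+1 = v].
Proof.
move=> uv.
pose K := [set f : {ptws nat -> R} | forall j, `[u, v]%classic (f j)].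
have cK : compact K.
  by apply: (@tychonoff nat (fun=> R) (fun=> `[u, v]%classic)) => _; exact: segment_compact.
have K0 : K !=set0 by exists (fun=> u) => j /=; rewrite in_itv /= lexx.
pose G j (f : {ptws nat -> R}) := if j == N.+1 then v else running_max u f j.
have cG j : continuous (G j).
  rewrite /G; case: eqP => _; first exact: cst_continuous.
  elim: j => [|j IH] /=; first exact: cst_continuous.
  by apply: max_continuous => //; exact: ptws_eval_continuous.
have cE : {within K, continuous (fun f => segment_energy H N.+1 (fun j => G j f))}.
  by apply: continuous_subspaceT; exact: continuous_segment_energy.
have [f fK fmin] := compact_EVT_min K0 cK cE.
have Guv g j : K g -> u <= running_max u g j <= v.
  move=> Kg; elim: j => [|j /andP[IH1 IH2]] /=; first by rewrite lexx.
  have := Kg j.+1; rewrite /= in_itv /= => /andP[g1 g2].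
  by rewrite le_max IH1 ge_max IH2 g2.
have Gnd g : K g -> nondecreasing_upto N.+1 (fun j => G j g).
  move=> Kg j k /andP[jk kN]; rewrite /G.
  have [kE|kE] := eqVneq k N.+1.
    by case: eqP => // _; have /andP[] := Guv g j Kg.
  rewrite ifF; last by apply/negbTE; rewrite neq_ltn; apply/orP; left; lia.
  rewrite -(subnKC jk); elim: (k - j)%N => [|d IH]; first by rewrite addn0.
  by rewrite addnS /= le_max IH.
rewrite inE in fK.
exists (fun j => G j f); split; [split; first exact: Gnd| by [] | by rewrite /G eqxx].
move=> t' nd'; rewrite /G /= eqxx => t0 tN.
have Kt j : (j <= N.+1)%N -> u <= t' j <= v.
  by move=> jN; rewrite -t0 -tN; apply/andP; split; apply: nd'; lia.
pose g : {ptws nat -> R} := fun j => if (j <= N.+1)%N then t' j else u.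
have Kg : K g.
  move=> j; rewrite /= in_itv /= /g; case: leqP => [|_]; [exact: Kt|by rewrite lexx].
have gE j : (j <= N.+1)%N -> G j g = t' j.
  move=> jN; rewrite /G; case: eqP => [->|_]; first by rewrite tN.
  elim: j jN => [|j IH] jN /=; first by rewrite t0.
  by rewrite IH ?(ltnW jN) // /g jN; apply/max_idPr; apply: nd'; lia.
have := fmin g; rewrite inE => /(_ Kg).
rewrite {2}/segment_energy (eq_big_nat _ _ (F2 := fun j => H (t' j) (t' j.+1))) //.
by move=> j /andP[_ jN]; rewrite !gE //; lia.
Qed.

Lemma minimal_segment_ext (p : nat) t t' : (forall j, (j <= p)%N -> t j = t' j) ->
  minimal_segment H p t -> minimal_segment H p t'.
Proof.
move=> tt [nd tmin]; split.
  by move=> j k /andP[jk kp]; rewrite -!tt //; [apply: nd; rewrite jk|lia].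
move=> r ndr r0 rp; rewrite [leLHS](_ : _ = segment_energy H p t).
  by apply: tmin => //; rewrite ?r0 ?rp tt.
by apply: eq_big_nat => j /andP[_ jp]; rewrite !tt //; lia.
Qed.

Lemma minimal_subsegment (N a p : nat) t : (a + p <= N)%N ->
  minimal_segment H N t -> minimal_segment H p (fun j => t (a + j)%N).
Proof.
move=> aN tmin; have [nd _] := tmin; split.
  by move=> j k /andP[jk kp]; apply: nd; lia.
case: p aN => [|p] aN t' nd' t0 tp; first by rewrite /segment_energy !big_geq.
have := @replace_piece _ _ _ _ tmin a p (stretch t' 1 p) aN (size_stretch _ _ _).
have E : rcons (stretch t' 1 p) (t (a + p.+1)%N) = stretch t' 1 p.+1.
  by rewrite stretchSr -tp.
rewrite E => h; have t0' : t' 0%N = t a by rewrite t0 addn0.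
have <- : chain_energy H (t a) (stretch t' 1 p.+1) = segment_energy H p.+1 t'.
  by rewrite -t0' (chain_energy_stretch _ _ 0) add0n.
have <- : chain_energy H (t a) (stretch t a.+1 p.+1) =
    segment_energy H p.+1 (fun j => t (a + j)%N).
  rewrite chain_energy_stretch /segment_energy -{1}[a]add0n big_addn addKn.
  by apply: eq_bigr => i _; rewrite addnS [(i + a)%N]addnC.
by apply: h; rewrite -t0'; apply: path_stretch => j k ? ?; apply: nd'; lia.
Qed.

(** A competitor that beats the limit is adapted continuously to the end points of nearby segments,
    and would beat them too. *)
Lemma minimal_segment_limit (f : {ptws int -> R}) (i : int) (p : nat) : (1 <= p)%N ->
  (forall B, nbhs f B -> exists g, B g /\ minimal_segment H p (fun j => g (i + j%:Z))) ->
  minimal_segment H p (fun j => f (i + j%:Z)).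
Proof.
move=> p1 lim.
have nd : nondecreasing_upto p (fun j => f (i + j%:Z)).
  move=> j k jk; rewrite leNgt; apply/negP => h.
  pose e := (f (i + j%:Z) - f (i + k%:Z)) / 2.
  have e0 : 0 < e by rewrite divr_gt0 // subr_gt0.
  have [g [[/ltr_normlP[g1 g2] /ltr_normlP[g3 g4]] [gnd _]]] :=
    lim _ (filterI (ptws_eval_near f (i + j%:Z) e0) (ptws_eval_near f (i + k%:Z) e0)).
  by have := gnd j k jk; rewrite /e in g1 g2 g3 g4; lra.
split => // t' nd' t0 tp; rewrite leNgt; apply/negP => h.
(* The competitor [t'] clamped between the end values of [g]; at [g = f] it is [t'] itself. *)
pose C j (g : {ptws int -> R}) : R := if j == 0%N then g (i + 0%N%:Z)
  else if j == p then g (i + p%:Z)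
  else Num.min (Num.max (t' j) (g (i + 0%N%:Z))) (g (i + p%:Z)).
have cC j : continuous (C j).
  rewrite /C; case: eqP => _; first exact: ptws_eval_continuous.
  case: eqP => _; first exact: ptws_eval_continuous.
  apply: min_continuous; last exact: ptws_eval_continuous.
  by apply: max_continuous; [exact: cst_continuous|exact: ptws_eval_continuous].
have CE j : (j <= p)%N -> C j f = t' j.
  move=> jp; rewrite /C; case: eqP => [->|_]; first by rewrite t0.
  case: eqP => [->|_]; first by rewrite tp.
  rewrite -t0 -tp (max_idPl _) ?(min_idPl _) //; apply: nd'; lia.
pose Phi (g : {ptws int -> R}) := segment_energy H p (fun j => g (i + j%:Z)) -
  segment_energy H p (fun j => C j g).
have cPhi : continuous Phi.
  apply: (@sub_continuous R {ptws int -> R}).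
    apply: (@continuous_segment_energy _ (fun j (g : {ptws int -> R}) => g (i + j%:Z))).
    by move=> j; exact: ptws_eval_continuous.
  exact: (@continuous_segment_energy _ C).
have Phi0 : 0 < Phi f.
  rewrite /Phi subr_gt0 [ltLHS](_ : _ = segment_energy H p t') //.
  by apply: eq_big_nat => j /andP[_ jp]; rewrite !CE //; lia.
have [g [/= gPhi [gnd gmin]]] := lim _ (cPhi f _ (nbhsx_ballx (Phi f) _ Phi0)).
have : 0 < Phi g.
  by move: gPhi; rewrite /ball /= => /ltr_normlP[? ?]; lra.
rewrite /Phi subr_gt0; apply/negP; rewrite -leNgt.
have C0 : C 0%N g = g (i + 0%N%:Z) by rewrite /C eqxx.
have Cp : C p g = g (i + p%:Z) by rewrite /C eqxx; case: eqP p1 => // ->.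
apply: gmin; [|exact: C0|exact: Cp].
  have g0p : g (i + 0%N%:Z) <= g (i + p%:Z) by apply: (gnd 0%N p); rewrite !leqnn.
  have Cb j : g (i + 0%N%:Z) <= C j g <= g (i + p%:Z).
    rewrite /C; case: eqP => _; first by rewrite lexx.
    by case: eqP => _; rewrite ?lexx ?g0p // le_min le_max lexx orbT g0p ge_min lexx orbT.
  move=> j k /andP[jk kp]; have [->|j0] := eqVneq j 0%N.
    by rewrite C0; have /andP[] := Cb k.
  have [->|kp'] := eqVneq k p; first by rewrite Cp; have /andP[] := Cb j.
  rewrite /C (negbTE j0) (negbTE kp').
  have -> : (k == 0%N) = false by apply/negbTE; rewrite -lt0n; lia.
  have -> : (j == p) = false by apply/negbTE; rewrite neq_ltn; apply/orP; left; lia.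
  have tjk : t' j <= t' k by apply: nd'; rewrite jk.
  by rewrite le_min !ge_min !ge_max !le_max !lexx tjk !orbT.
Qed.

End MinimalExistence.

(** * Configurations with prescribed rotation number *)

Section MeanGapEstimate.
Context {R : realType}.

(** [S] is the length of a window of the limit, [St] that of its approximation, [n] the number of
    steps times [r], and [r] the prescribed rotation number. *)
Lemma mean_gap_estimate (e S St n r : R) : 0 < e -> e <= 1 -> 0 <= r -> 1 <= S ->
  St <= S + e -> S <= St + e -> n <= (1 + e + e * r) * St ->
  St <= (1 + e) * n + e * r * St ->
  n <= S + e * (5 + 4 * r) * S /\ S <= n + e * (5 + 4 * r) * S.
Proof.
move=> e0 e1 r0 S0 S1 S2 P1 P2.
have S00 : 0 <= S by lra.
have Se : e <= e * S by rewrite ler_peMr // ltW.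
have er : 0 <= e * r by rewrite mulr_ge0 // ltW.
have c0 : 0 <= 1 + e + e * r by lra.
have ee : e * e <= e by rewrite ler_piMr // ltW.
have eer : e * e * r <= e * r by rewrite ler_wpM2r.
have A1 : n <= S + e * (3 + 2 * r) * S.
  apply: (le_trans P1); apply: (@le_trans _ _ ((1 + e + e * r) * (S + e * S))).
    by rewrite ler_wpM2l //; move: S1 Se; olra.
  have : (1 + e + e * r) * (1 + e) <= 1 + e * (3 + 2 * r) by move: ee eer; olra.
  by move=> /(ler_wpM2r S00); olra.
have C : e * (3 + 2 * r) * S <= e * (5 + 4 * r) * S.
  by rewrite ler_wpM2r // ler_pM2l //; move: r0; olra.
split; first by move: A1 C; olra.
have h1 : e * r * St <= e * r * (S + e * S) by rewrite ler_wpM2l //; move: S1 Se; olra.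
have h2 : e * e * r * S <= e * r * S by rewrite ler_wpM2r.
have h3 : e * n <= e * ((4 + 2 * r) * S).
  rewrite ler_pM2l //; apply: (le_trans A1).
  have : e * (3 + 2 * r) <= 3 + 2 * r by rewrite ler_piMl // addr_ge0 // mulr_ge0.
  by move=> /(ler_wpM2r S00); olra.
by move: S2 P2 h1 h2 h3 Se; olra.
Qed.

End MeanGapEstimate.

Section PrescribedRotation.
Context {R : realType}.

Variables U V : R -> R.
Hypothesis cU : continuous U.
Hypothesis cV : continuous V.

Local Notation H := (FK_energy U V).

Hypothesis window : uniform_density H.

Hypothesis jumps : uniform_jump_bound H.

Variable rho : R.
Hypothesis rho0 : 0 < rho.

Definition has_mean_gap (N : nat) (t : nat -> R) :=
  minimal_segment H N t /\ t N - t 0%N = rho * N%:R.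

(** The whole segment is itself a window, of known density [rho^-1]; it serves once as the crossed
    window and once as the other one. *)
Lemma mean_gap_window (e : R) : 0 < e -> exists2 M : R, 0 < M &
  forall N t, has_mean_gap N t -> M <= rho * N%:R ->
  forall i j, (i <= j <= N)%N ->
    (forall L, M <= L -> t j - t i <= L -> (j - i)%:R * rho <= (1 + e + e * rho) * L) /\
    (M <= t j - t i ->
      t j - t i <= (1 + e) * ((j - i)%:R * rho) + e * rho * (t j - t i)).
Proof.
move=> e0; have [M M0 MP] := window e0; exists M => // N t [tmin tN] MN i j ijN.
have N0 : 0 < N%:R :> R by rewrite -(pmulr_rgt0 _ rho0); apply: lt_le_trans MN.
split=> [L ML tL|MS].
  have := MP N t tmin i j 0%N N (t i) L (t 0%N) (rho * N%:R) ijN (leqnn _) ML MN (lexx _).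
  rewrite subn0 => /(_ ltac:(lra) (lexx _) ltac:(lra)) h.
  by rewrite -(ler_pM2r N0); lra.
have := MP N t tmin 0%N N i j (t 0%N) (rho * N%:R) (t i) (t j - t i)
  (leqnn _) ijN MN MS (lexx _).
rewrite subn0 => /(_ ltac:(lra) (lexx _) ltac:(lra)) h.
by rewrite -(ler_pM2r N0); lra.
Qed.

Lemma lipschitz_segment (N : nat) (t : nat -> R) (K : R) :
  (forall k, (k < N)%N -> t k.+1 - t k <= K) ->
  forall a b, (a <= b <= N)%N -> t b - t a <= K * (b - a)%:R.
Proof.
move=> tK a b /andP[ab bN]; rewrite -(subnKC ab) in bN *; rewrite addKn.
elim: (b - a)%N bN => [|d IH] bN; first by rewrite addn0 subrr mulr0.
have := tK (a + d)%N ltac:(lia); have := IH ltac:(lia).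
by rewrite addnS -natr1 mulrDr mulr1; lra.
Qed.

(** Centering at an index [a] far from both ends, with growth controlled by a fixed [K], gives the
    compactness needed for a limit. *)
Lemma centered_segment : exists2 K : R, 0 < K &
  forall (m : nat) (W : R), exists N t a,
    [/\ has_mean_gap N t, (m <= a)%N /\ (a + m <= N)%N, W <= rho * N%:R
      & forall j, (j <= N)%N -> `|t j| <= K * (`|j%:Z - a%:Z|%N%:R + 1)].
Proof.
have [K K0 KP] := jumps (5 * rho); exists K => // m W.
(* The segment makes [10 * q] steps from [- 5 * rho * q] to [5 * rho * q]. The first term makes it
   longer than [W]; the second forces more than [m] steps on either side of 0. *)
pose q := (Num.bound (`|W| / rho) + Num.bound (K * (m + 1)%:R / (5 * rho))).+1.
have r5 : 0 < 5 * rho by rewrite mulr_gt0.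
have q1 : `|W| <= rho * q%:R.
  rewrite mulrC -ler_pdivrMr //; apply: ltW.
  apply: (@lt_le_trans _ _ (Num.bound (`|W| / rho))%:R).
    by rewrite archi_boundP // divr_ge0 // ltW.
  by rewrite ler_nat /q; ilia.
have q2 : K * (m + 1)%:R <= 5 * rho * q%:R.
  rewrite [leRHS]mulrC -ler_pdivrMr //; apply: ltW.
  apply: (@lt_le_trans _ _ (Num.bound (K * (m + 1)%:R / (5 * rho)))%:R).
    by rewrite archi_boundP // divr_ge0 ?mulr_ge0 // ltW.
  by rewrite ler_nat /q; ilia.
have Q0 : 0 < 5 * rho * q%:R by rewrite mulr_gt0 // ltr0n.
have [t [tmin t0 tN]] := @minimal_segment_exists R U V cU cV (10 * q).-1
  (- (5 * rho * q%:R)) (5 * rho * q%:R) ltac:(lra).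
have NE : (10 * q).-1.+1 = (10 * q)%N by rewrite /q; ilia.
rewrite NE in tmin tN; set N := (10 * q)%N in tmin tN NE.
have NR : N%:R = 10 * q%:R :> R by rewrite /N natrM.
(* Pigeonhole over [2 * q] groups of five steps; the jump bound then applies with a [K] independent
   of [q]. *)
have [i [iN iL]] : exists i, (i + 5 <= N)%N /\ t (i + 5)%N - t i <= 5 * rho.
  apply: contrapT => nex.
  have big i : (i + 5 <= N)%N -> 5 * rho < t (i + 5)%N - t i.
    by move=> iN; rewrite ltNge; apply/negP => h; apply: nex; exists i.
  have grow r : (r < 2 * q)%N -> 5 * rho * r.+1%:R < t (5 * r.+1)%N - t 0%N.
    elim: r => [|r IH] rq.
      by have := big 0%N; rewrite add0n mulr1 muln1; apply; rewrite /N; ilia.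
    have := big (5 * r.+1)%N; rewrite (_ : (5 * r.+1 + 5 = 5 * r.+2)%N); last by ilia.
    move=> /(_ ltac:(rewrite /N; ilia)); have := IH ltac:(ilia).
    by rewrite -[r.+2%:R]natr1 mulrDr mulr1; lra.
  have := grow (2 * q).-1; rewrite prednK; last by rewrite /q; ilia.
  rewrite (_ : (5 * (2 * q) = N)%N); last by rewrite /N; ilia.
  move=> /(_ ltac:(rewrite /q; ilia)); rewrite tN t0 natrM; lra.
have tK := KP N t tmin i iN iL.
have lip := lipschitz_segment tK.
have [|||a [/andP[_ aN] ta ta']] := @exists_last_true (fun i => t i <= 0) 0 N => //.
- by rewrite t0; lra.
- by rewrite -ltNge tN.
rewrite -ltNge in ta'.
have taK : - K < t a by have := tK a aN; lra.
have tnd j k : (j <= k)%N -> (k <= N)%N -> t j <= t k.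
  by move=> jk kN; apply: tmin.1; rewrite jk.
exists N, t, a; split.
- by split => //; rewrite tN t0 NR; lra.
- split.
    have := lip 0%N a ltac:(ilia); rewrite subn0 t0 => h.
    have : K * (m + 1)%:R < K * (a + 1)%:R by rewrite [in ltRHS]natrD; lra.
    by rewrite ltr_pM2l // ltr_nat; ilia.
  have := lip a N ltac:(ilia); rewrite tN => h.
  have : K * (m + 1)%:R <= K * (N - a)%:R by lra.
  by rewrite ler_pM2l // ler_nat; ilia.
- have qq : 0 <= rho * q%:R by exact: (mulr_ge0 (ltW rho0) (ler0n _ _)).
  by rewrite NR; have := ler_norm W; lra.
- move=> j jN; have [aj|ja] := leqP a j.
    have -> : `|j%:Z - a%:Z|%N = (j - a)%N by ilia.
    have := lip a j ltac:(ilia); have := tnd a j aj jN => h1 h2.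
    have : 0 <= K * (j - a)%:R by rewrite mulr_ge0 // ltW.
    by rewrite mulrDr mulr1 => h3; apply/ler_normlP; split; move: h1 h2 h3 ta taK K0; olra.
  have -> : `|j%:Z - a%:Z|%N = (a - j)%N by ilia.
  have := lip j a ltac:(ilia); have := tnd j a (ltnW ja) (ltnW aN) => h1 h2.
  have : 0 <= K * (a - j)%:R by rewrite mulr_ge0 // ltW.
  by rewrite mulrDr mulr1 => h3; apply/ler_normlP; split; move: h1 h2 h3 ta taK K0; olra.
Qed.

(** The second part is what survives in the limit: each pair of coordinates is approximated by a
    pair at the same index distance in arbitrarily long segments of mean gap [rho]. *)
Lemma limit_configuration : exists theta : int -> R,
  minimal_configuration H theta /\
  forall (i j : int) (eta W : R), i <= j -> 0 < eta -> exists N t (i' j' : nat),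
    [/\ has_mean_gap N t, W <= rho * N%:R, (i' <= j' <= N)%N, (j' - i')%N%:Z = j - i &
      `|t i' - theta i| < eta /\ `|t j' - theta j| < eta].
Proof.
have [K K0 KP] := centered_segment.
have ex (m : nat) : exists T : nat * (nat -> R) * nat,
    [/\ has_mean_gap T.1.1 T.1.2, (m <= T.2)%N /\ (T.2 + m <= T.1.1)%N,
      m%:R <= rho * T.1.1%:R
      & forall j, (j <= T.1.1)%N -> `|T.1.2 j| <= K * (`|j%:Z - T.2%:Z|%N%:R + 1)].
  by have [N [t [a h]]] := KP m m%:R; exists (N, t, a).
have [T TP] := choice ex.
pose N m := (T m).1.1; pose t m := (T m).1.2; pose a m := (T m).2.
(* The segment recentred at [a m]. The indices used lie within it when [|n| <= m]; the value 0
   elsewhere only keeps [tau m] in the compact set [C]. *)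
pose tau (m : nat) : {ptws int -> R} :=
  fun n => if (`|n| <= m)%N then t m `|((a m)%:Z + n)%R|%N else 0.
pose C := [set f : {ptws int -> R} |
  forall n, `[- (K * (`|n|%N%:R + 1)), K * (`|n|%N%:R + 1)]%classic (f n)].
have cC : compact C.
  apply: (@tychonoff int (fun=> R)
    (fun n => `[- (K * (`|n|%N%:R + 1)), K * (`|n|%N%:R + 1)]%classic)) => n.
  exact: segment_compact.
have tauC m : C (tau m).
  move=> n /=; rewrite in_itv /= -ler_norml /tau; case: leqP => nm; last first.
    by rewrite normr0 mulr_ge0 ?addr_ge0 // ltW.
  have [_ [am1 am2] _ h] := TP m.
  have := h `|((a m)%:Z + n)%R|%N ltac:(rewrite /a; lia).
  rewrite (_ : `|(`|((a m)%:Z + n)%R|%N)%:Z - (T m).2%:Z|%N = `|n|%N) //.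
  by rewrite -/(a m); rewrite -/(a m) in am1 am2; lia.
have tauF : (tau @ \oo) C by exists 0%N => // m _; exact: tauC.
have [theta [_ thetaP]] := cC (tau @ \oo) _ tauF.
(* A cluster point suffices: every neighbourhood contains some [tau m] with [m] as large as
   desired. *)
have cluster (B : set {ptws int -> R}) (m0 : nat) : nbhs theta B ->
    exists2 m, (m0 <= m)%N & B (tau m).
  move=> nB; have [_ [[m mm <-] Bm]] := thetaP [set tau m | m in [set m | (m0 <= m)%N]] B
    ltac:(by exists m0 => // m /= mm; exists m) nB.
  by exists m.
have tauE m (n : int) : (`|n| <= m)%N -> tau m n = t m `|((a m)%:Z + n)%R|%N.
  by rewrite /tau => ->.
have block (i : int) (p : nat) : (1 <= p)%N -> minimal_segment H p (fun j => theta (i + j%:Z)).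
  move=> p1; apply: (minimal_segment_limit cU cV) => // B nB.
  have [m mm Bm] := cluster B (`|i| + p)%N nB.
  exists (tau m); split => //; have [[tmin _] [am1 am2] _ _] := TP m.
  rewrite -/(a m) -/(N m) in am1 am2.
  have aN : (`|((a m)%:Z + i)%R|%N + p <= N m)%N by lia.
  apply: minimal_segment_ext (minimal_subsegment aN tmin) => j jp.
  by rewrite tauE; [congr (t m _); lia|lia].
exists theta; split.
  split=> // i j ij; have := (block i `|j - i|.+1%N isT).1 0%N `|j - i|%N.
  rewrite addr0 (_ : i + `|j - i|%N%:Z = j); last by lia.
  by apply; lia.
move=> i j eta W ij eta0.
have [m mm [/= mi mj]] := cluster _ (`|i| + `|j| + Num.bound `|W|)%N
  (filterI (ptws_eval_near theta i eta0) (ptws_eval_near theta j eta0)).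
have [tg [am1 am2] mW _] := TP m; rewrite -/(a m) -/(N m) in am1 am2 mW.
exists (N m), (t m), `|((a m)%:Z + i)%R|%N, `|((a m)%:Z + j)%R|%N; split => //.
- apply: le_trans mW; apply: le_trans (ler_norm _) _; apply: ltW.
  apply: (@lt_le_trans _ _ (Num.bound `|W|)%:R); first exact: archi_boundP.
  by rewrite ler_nat; lia.
- lia.
- lia.
- have [im jm] : (`|i| <= m)%N /\ (`|j| <= m)%N by lia.
  by rewrite -!tauE.
Qed.

Lemma prescribed_rotation : exists theta : int -> R,
  minimal_configuration H theta /\ has_rotation_number theta rho.
Proof.
have [theta [tmin approx]] := limit_configuration.
have [tmono _] := tmin; exists theta; split => //.
have [W1 W10 W1P] := wide_unbounded window.
have tu : unbounded theta.
  have [M M0 MP] := mean_gap_window ltr01.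
  pose L := Num.max M (W1 + 1).
  have ML : M <= L by rewrite le_max lexx.
  have WL : W1 + 1 <= L by rewrite le_max lexx orbT.
  (* More steps than a mean-gap segment can make within length [L], so [theta] has a window of width
     [W1]. *)
  pose n := Num.bound ((1 + 1 + 1 * rho) * L / rho).
  have L0 : 0 < L := lt_le_trans M0 ML.
  have nP : (1 + 1 + 1 * rho) * L < n%:R * rho.
    rewrite -ltr_pdivrMr // archi_boundP // divr_ge0 // ?mulr_ge0 ?addr_ge0 ?mulr_ge0 //
      ltW //.
  apply: (W1P theta tmin 0 n%:Z) => //.
  rewrite leNgt; apply/negP => h.
  have [N [t [i [j [tg MN ijN ij [hi hj]]]]]] := approx 0 n%:Z (2^-1) M isT ltac:(lra).
  have [P1 _] := MP N t tg MN i j ijN.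
  have tL : t j - t i <= L by move: hi hj => /ltr_normlP[? ?] /ltr_normlP[? ?]; lra.
  have := P1 L ML tL; rewrite (_ : (j - i)%N = n); last by ilia.
  by rewrite leNgt nP.
rewrite -[rho]invrK; apply: density_rotation => //.
split=> [|e' e'0]; first by rewrite invr_gt0.
(* The estimate concerns [rho] times the number of steps, hence the factor [rho] in front of
   [e']. *)
have [e [e0 e1 ee]] : exists e, [/\ 0 < e, e <= 1 & e * (5 + 4 * rho) <= rho * e'].
  have c0 : 0 < 5 + 4 * rho by rewrite addr_gt0 // mulr_gt0.
  exists (Num.min 1 (rho * e' / (5 + 4 * rho))).
  rewrite lt_min ltr01 divr_gt0 // ?mulr_gt0 // ge_min lexx; split => //.
  by rewrite -ler_pdivlMr // ge_min lexx orbT.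
have [M M0 MP] := mean_gap_window e0.
exists (M + 1) => i j ij wS.
have [N [t [i' [j' [tg MN ijN ij' [hi hj]]]]]] :=
  approx i j (e / 2) M ij (divr_gt0 e0 (ltr0Sn _ 1)).
have [P1 P2] := MP N t tg MN i' j' ijN.
set S := theta j - theta i in wS *.
have [S1 S2] : t j' - t i' <= S + e /\ S <= t j' - t i' + e.
  by move: hi hj => /ltr_normlP[h1 h2] /ltr_normlP[h3 h4]; rewrite /S; split;
    move: h1 h2 h3 h4; olra.
have MS : M <= t j' - t i' by move: wS S2 e1; olra.
have {}P2 := P2 MS; have {}P1 := P1 _ MS (lexx _).
have E : (j' - i')%:R = (j - i)%:~R :> R by rewrite pmulrn ij'.
rewrite E in P1 P2.
set n : R := (j - i)%:~R * rho in P1 P2; set St := t j' - t i' in S1 S2 P1 P2.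
have S0 : 1 <= S by move: wS M0; olra.
have S00 : 0 <= S by move: S0; olra.
have [A1 A2] := mean_gap_estimate e0 e1 (ltW rho0) S0 S1 S2 P1 P2.
have B : e * (5 + 4 * rho) * S <= rho * e' * S by rewrite ler_wpM2r.
rewrite -(ler_pM2l rho0) -{1}(gtr0_norm rho0) -normrM.
rewrite mulrBr mulrA divff ?gt_eqF // mul1r (mulrC rho) -/n.
by apply/ler_normlP; split; move: A1 A2 B; olra.
Qed.

End PrescribedRotation.

Lemma derivable_continuous (R : realType) (f : R -> R) :
  (forall x, derivable f x 1) -> continuous f.
Proof. by move=> df x; apply/differentiable_continuous/derivable1_diffP. Qed.

(** A nondecreasing competitor with equal end values is constant. *)
Lemma constant_minimal (R : realType) (H : R -> R -> R) (c : R) :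
  minimal_configuration H (fun=> c).
Proof.
split=> [//|i p _]; split=> [//|t' nd t0 tp].
rewrite le_eqVlt; apply/orP; left; apply/eqP/eq_big_nat => j /andP[_ jp].
have tE k : (k <= p)%N -> t' k = c.
  move=> kp; apply/eqP; rewrite eq_le -{1}tp -t0; apply/andP; split; apply: nd.
    by rewrite kp leqnn.
  by rewrite kp.
by rewrite !tE // ltnW.
Qed.

Theorem theorem1p1 (R : realType) (s : int -> R) (V U : R -> R)
    (hs : quasicrystal s)
    (hV2 : C2 V) (hV : short_range_potential s V)
    (hU2 : C2 U) (hUconv : forall x : R, 0 < U^`(2) x)
    (hUpinfty : U x / `|x| @[x --> +oo] --> +oo)
    (hUninfty : U x / `|x| @[x --> -oo] --> +oo) :
  [/\ forall theta : int -> R,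
        minimal_configuration (FK_energy U V) theta ->
        exists rho : R, has_rotation_number theta rho,
      {within [set theta : {ptws int -> R} |
                 minimal_configuration (FK_energy U V) theta],
        continuous (@rotation_number R)}
    & forall rho : R, 0 <= rho ->
        exists theta : int -> R,
          minimal_configuration (FK_energy U V) theta /\
          has_rotation_number theta rho].
Proof.
have [dU ddU _] := hU2; have [dV _ _] := hV2.
have window := window_density hs hV dU ddU hUconv dV.
have jumps := bounded_jumps hs hV dU ddU hUconv dV.
split.
- have [M1 _ M1P] := minimal_rotation window jumps.
  move=> theta /M1P[[_ [b _ tr]]|[_ tr]]; first by exists b^-1.
  by exists 0.
- exact: rotation_number_continuous window jumps.
- move=> rho; rewrite le_eqVlt => /orP[/eqP <-|rho0].
    exists (fun=> 0); split; first exact: constant_minimal.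
    by apply: (@bounded_rotation _ _ 0) => n; rewrite normr0.
  exact: (prescribed_rotation (derivable_continuous dU) (derivable_continuous dV)
    window jumps rho0).
Qed.
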